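(* Let $r\ge2$, and for $i=1,\dots,r$ let $A_i=R_i/\mathfrak a_i$ be a standard graded ring with $\mathfrak a_i\subseteq(\mathbf x_i)^2$ a homogeneous ideal. With $N=n_1+\cdots+n_r$, $$P^Q_{A_1\times_K\cdots\times_K A_r}(t,s)=\sum_{i=1}^r(P^{R_i}_{A_i}(t,s)-1)(1+st)^{N-n_i}+(r-1)\frac{(1+st)^N-Nst-1}{t}-\sum_{i=1}^r\frac{(1+st)^{N-n_i}-(N-n_i)st-1}{t}+1.$$
   Context: $K$ is an arbitrary field. For $i=1,\dots,r$, $R_i=K[x_{i,1},\dots,x_{i,n_i}]$ ($n_i\ge1$) is a standard graded polynomial ring with irrelevant ideal $\mathbf x_i=(x_{i,1},\dots,x_{i,n_i})$, and $Q=R_1\otimes_K\cdots\otimes_K R_r$. With canonical projections $\pi_i:A_i\to K$, the fiber product is $A_1\times_K\cdots\times_K A_r=\{(a_1,\dots,a_r)\in A_1\oplus\cdots\oplus A_r\mid\pi_i(a_i)=\pi_j(a_j)\ \forall i,j\}$, a quotient of $Q$. For a polynomial ring $P$ and graded $P$-module $M$, $P^P_M(t,s)=\sum_{i,j}\dim_K[\operatorname{Tor}^P_i(M,K)]_j\,t^is^j$. *)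

(* Defs.v *)
From Stdlib Require Import ClassicalEpsilon.
From HB Require Import structures.
From mathcomp Require Import all_boot all_order all_algebra.
From mathcomp Require Import ring_quotient mpoly.

Set Implicit Arguments.
Unset Strict Implicit.
Unset Printing Implicit Defensive.

Import GRing.Theory.
Local Open Scope ring_scope.
Local Open Scope quotient_scope.

Definition resmod (P B : pzRingType) (f : {rmorphism P -> B}) : Type := B.

Section ResMod.
Variables (P B : pzRingType) (f : {rmorphism P -> B}).

HB.instance Definition _ := GRing.Zmodule.copy (resmod f) B.

Definition resmod_scale (p : P) (b : resmod f) : resmod f := f p * (b : B).

Fact resmod_scaleA p q b :
  resmod_scale p (resmod_scale q b) = resmod_scale (p * q) b.
Proof. by rewrite /resmod_scale rmorphM mulrA. Qed.
Fact resmod_scale1 : left_id 1 resmod_scale.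
Proof. by move=> b; rewrite /resmod_scale rmorph1 mul1r. Qed.
Fact resmod_scaleDr : right_distributive resmod_scale +%R.
Proof. by move=> p b c; rewrite /resmod_scale mulrDr. Qed.
Fact resmod_scaleDl b : {morph resmod_scale^~ b : p q / p + q}.
Proof. by move=> p q; rewrite /resmod_scale rmorphD mulrDl. Qed.

HB.instance Definition _ := GRing.Zmodule_isLmodule.Build P (resmod f)
  resmod_scaleA resmod_scale1 resmod_scaleDr resmod_scaleDl.

End ResMod.

Record gmodule (K : fieldType) (n : nat) := GModule {
  gcar :> lmodType {mpoly K[n]};
  gpart : nat -> gcar -> Prop;
  gpart0 : forall d, gpart d 0;
  gpartD : forall d x y, gpart d x -> gpart d y -> gpart d (x + y);
  gpartM : forall d e p x,
    p \is d.-homog -> gpart e x -> gpart (d + e) (p *: x);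
  gpart_sum : forall x, exists m (c : nat -> gcar),
    (forall d, gpart d (c d)) /\ x = \sum_(d < m) c d;
  gpart_direct : forall m (c : nat -> gcar), (forall d, gpart d (c d)) ->
    \sum_(d < m) c d = 0 -> forall d, (d < m)%N -> c d = 0
}.

Section Tor.
Variables (K : fieldType) (n : nat).
Local Notation P := {mpoly K[n]}.

(* Augmented sequences ... -> F_1 -> F_0 -> N with
   F_i = \bigoplus_(k < rk i) P(- sh i k); elements of F_i are row vectors,
   and the differential F_(i+1) -> F_i is v |-> v *m dif i. *)
Record free_seq (N : lmodType P) := FreeSeq {
  rk : nat -> nat;
  sh : forall i, 'I_(rk i) -> nat;
  dif : forall i, 'M[P]_(rk i.+1, rk i);
  aug : 'I_(rk 0) -> N
}.

Arguments rk {N}.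
Arguments sh {N} _ _ _.
Arguments dif {N} _ _.
Arguments aug {N} _ _.

Definition free_seq0 (N : lmodType P) : free_seq N :=
  @FreeSeq N (fun=> 0) (fun _ _ => 0) (fun=> 0) (fun=> 0).

Definition augmap (N : lmodType P) (F : free_seq N) (v : 'rV[P]_(rk F 0)) : N :=
  \sum_k v 0 k *: aug F k.

Arguments augmap {N}.

Definition graded_free_resolution (N : gmodule K n) (F : free_seq N) : Prop :=
  [/\ forall i (k : 'I_(rk F i.+1)) (l : 'I_(rk F i)),
        if (sh F i l <= sh F i.+1 k)%N then dif F i k l \is (sh F i.+1 k - sh F i l).-homog
        else dif F i k l == 0,
      forall k : 'I_(rk F 0), gpart (sh F 0 k) (aug F k),
      forall x : N, exists v, augmap F v = x,
      forall v : 'rV_(rk F 0), augmap F v = 0 <-> exists w, v = w *m dif F 0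
    & forall i (v : 'rV_(rk F i.+1)),
        v *m dif F i = 0 <-> exists w, v = w *m dif F i.+1].

(* Some graded free resolution by finitely generated free modules; one exists
   when N is finitely generated, and Tor does not depend on the choice. *)
Definition resolution (N : gmodule K n) : free_seq N :=
  epsilon (inhabits (free_seq0 N)) (@graded_free_resolution N).

(* The complex M (x)_P F, with M (x)_P F_i = \bigoplus_(k < rk i) M(- sh i k). *)
Section TensorComplex.
Variables (M : gmodule K n) (N : lmodType P) (F : free_seq N).

Definition tens_part i j (v : {ffun 'I_(rk F i) -> M}) : Prop :=
  forall k, if (sh F i k <= j)%N then gpart (j - sh F i k) (v k) else v k = 0.

Definition tens_dif i (v : {ffun 'I_(rk F i.+1) -> M}) : {ffun 'I_(rk F i) -> M} :=
  [ffun l => \sum_k dif F i k l *: v k].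

Definition tens_cycle i j (v : {ffun 'I_(rk F i) -> M}) : Prop :=
  tens_part j v /\
  match i return {ffun 'I_(rk F i) -> M} -> Prop with
  | 0 => fun=> True
  | i'.+1 => fun v => tens_dif v = 0
  end v.

Definition tens_boundary i j (v : {ffun 'I_(rk F i) -> M}) : Prop :=
  exists2 w, @tens_part i.+1 j w & tens_dif w = v.

End TensorComplex.

(* [dim_quot Z B] is the K-dimension of Z / B for K-subspaces B <= Z of V
   (a junk value if it is infinite). *)
Definition has_dim_quot (V : lmodType P) (Z B : V -> Prop) (m : nat) : Prop :=
  exists e : 'I_m -> V,
    [/\ forall k, Z (e k),
        forall v, Z v ->
          exists c : 'I_m -> K, B (v - \sum_k (c k)%:MP *: e k)
      & forall c : 'I_m -> K,
          B (\sum_k (c k)%:MP *: e k) -> forall k, c k = 0].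

Definition dim_quot (V : lmodType P) (Z B : V -> Prop) : nat :=
  epsilon (inhabits 0%N) (has_dim_quot Z B).

(* dim_K [Tor^P_i(M, N)]_j, Tor being computed by a graded free resolution of
   the second argument. *)
Definition tor_dim (M N : gmodule K n) (i j : nat) : nat :=
  dim_quot (@tens_cycle M N (resolution N) i j)
           (@tens_boundary M N (resolution N) i j).

End Tor.

Section ResidueField.
Variables (K : fieldType) (n : nat).
Local Notation P := {mpoly K[n]}.

Definition mcoeff0r : {rmorphism P -> K} := mcoeff (0%MM : 'X_{1..n}).

Definition resfield_part (d : nat) (x : resmod mcoeff0r) : Prop :=
  d = 0%N \/ x = 0.

Fact resfield_part0 d : resfield_part d 0.
Proof. by right. Qed.

Fact resfield_partD d x y :
  resfield_part d x -> resfield_part d y -> resfield_part d (x + y).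
Proof. by case=> [->|->]; [left|case=> [->|->]; [left|right; rewrite addr0]]. Qed.

Lemma homog_mcoeff0 d (p : P) : p \is d.-homog -> (0 < d)%N -> p@_0%MM = 0.
Proof.
move=> hp d0; apply: memN_msupp_eq0; apply/negP => /(dhomogP _ _ _ hp).
by rewrite /= mdeg0 => d_eq; rewrite -d_eq in d0.
Qed.

Fact resfield_partM d e (p : P) x :
  p \is d.-homog -> resfield_part e x -> resfield_part (d + e) (p *: x).
Proof.
case: (posnP d) => [->|d0] hp [->|->].
- by left.
- by right; rewrite scaler0.
- by right; rewrite /GRing.scale /= /resmod_scale /= (homog_mcoeff0 hp d0) mul0r.
- by right; rewrite scaler0.
Qed.

Fact resfield_part_sum (x : resmod mcoeff0r) :
  exists m (c : nat -> resmod mcoeff0r),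
    (forall d, resfield_part d (c d)) /\ x = \sum_(d < m) c d.
Proof.
exists 1%N, (fun d => if d == 0%N then x else 0); split; last by rewrite big_ord1.
by case=> [|d]; [left|right].
Qed.

Fact resfield_part_direct m (c : nat -> resmod mcoeff0r) :
  (forall d, resfield_part d (c d)) ->
  \sum_(d < m) c d = 0 -> forall d, (d < m)%N -> c d = 0.
Proof.
move=> hc s0; have c0 d : (0 < d)%N -> c d = 0 by case: d => // d; case: (hc d.+1).
move=> [|d] dm; last exact: c0.
case: m => // m in s0 dm *; rewrite big_ord_recl big1 ?addr0 // in s0.
by move=> i _; rewrite c0.
Qed.

Definition resfield : gmodule K n :=
  GModule resfield_part0 resfield_partD resfield_partM resfield_part_sum
          resfield_part_direct.

End ResidueField.

(* An [idealr] is a proper ideal. Homogeneity: a contains the homogeneous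
   components of its elements. *)
Record hideal (K : fieldType) (n : nat) := HIdeal {
  hideal_val :> idealr {mpoly K[n]};
  hideal_homog : forall (p : {mpoly K[n]}) d,
    p \in hideal_val -> pihomog mdeg d p \in hideal_val
}.

Definition galg (K : fieldType) (n : nat) (a : hideal K n) : comNzRingType :=
  {ideal_quot a}.

Section GradedAlgebra.
Variables (K : fieldType) (n : nat) (a : hideal K n).
Local Notation P := {mpoly K[n]}.
Local Notation A := (galg a).

Definition galg_pi : {rmorphism P -> A} := \pi_({ideal_quot a}).

Lemma galg_pi_eq p q : (galg_pi p = galg_pi q) <-> (p - q \in (a : idealr _)).
Proof.
rewrite Quotient.idealrBE; split => [h|/eqP//]; exact/eqP.
Qed.

Lemma galg_piK (x : A) : galg_pi (repr x) = x.
Proof. exact: reprK. Qed.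

Definition gcomp d (x : A) : A := galg_pi (pihomog mdeg d (repr x)).

Lemma gcomp_pi d p : gcomp d (galg_pi p) = galg_pi (pihomog mdeg d p).
Proof.
apply/galg_pi_eq; rewrite -raddfB; apply: hideal_homog.
by apply/galg_pi_eq; rewrite galg_piK.
Qed.

Lemma gcompD d : {morph gcomp d : x y / x + y}.
Proof.
move=> x y; rewrite -[x]galg_piK -[y]galg_piK -rmorphD !gcomp_pi.
by rewrite -rmorphD raddfD.
Qed.

Lemma gcomp0 d : gcomp d 0 = 0.
Proof. by rewrite -(rmorph0 galg_pi) gcomp_pi raddf0. Qed.

Lemma gcomp_sum d m (c : nat -> A) :
  gcomp d (\sum_(i < m) c i) = \sum_(i < m) gcomp d (c i).
Proof. exact: (big_morph _ (gcompD d) (gcomp0 d)). Qed.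

Definition galg_part (d : nat) (x : resmod galg_pi) : Prop :=
  exists2 p : P, p \is d.-homog & galg_pi p = x.

Lemma gcomp_part d x : galg_part d (gcomp d x).
Proof. by exists (pihomog mdeg d (repr x)); first exact: pihomogP. Qed.

Lemma gcomp_id d x : galg_part d x -> gcomp d x = x.
Proof. by case=> p hp <-; rewrite gcomp_pi pihomog_dE. Qed.

Lemma gcomp_ne d e x : galg_part d x -> d != e -> gcomp e x = 0.
Proof. by case=> p hp <- de; rewrite gcomp_pi (pihomog_ne0 de hp) rmorph0. Qed.

Lemma gcomp_partition m (x : A) :
  (msize (repr x) <= m)%N -> x = \sum_(d < m) gcomp d x.
Proof.
move=> le_m; rewrite -[LHS]galg_piK (pihomog_partitionE le_m) rmorph_sum /=.
by apply: eq_bigr.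
Qed.

Fact galg_part0 d : galg_part d 0.
Proof. by exists 0; [exact: rpred0 | exact: rmorph0]. Qed.

Fact galg_partD d x y : galg_part d x -> galg_part d y -> galg_part d (x + y).
Proof.
by case=> p hp <- [q hq <-]; exists (p + q); [exact: rpredD | exact: rmorphD].
Qed.

Fact galg_partM d e (p : P) x :
  p \is d.-homog -> galg_part e x -> galg_part (d + e) (p *: x).
Proof.
by move=> hp [q hq <-]; exists (p * q); [exact: dhomogM | exact: rmorphM].
Qed.

Fact galg_part_sum (x : resmod galg_pi) :
  exists m (c : nat -> resmod galg_pi),
    (forall d, galg_part d (c d)) /\ x = \sum_(d < m) c d.
Proof.
exists (msize (repr (x : A))), (fun d => gcomp d x).
by split; [move=> d; exact: gcomp_part | exact: gcomp_partition].
Qed.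

Fact galg_part_direct m (c : nat -> resmod galg_pi) :
  (forall d, galg_part d (c d)) ->
  \sum_(d < m) c d = 0 -> forall d, (d < m)%N -> c d = 0.
Proof.
move=> hc s0 d dm; have := gcomp0 d; rewrite -{1}[0]s0 gcomp_sum.
rewrite (bigD1 (Ordinal dm)) //= big1 ?addr0 ?gcomp_id // => i ne_i.
exact: gcomp_ne.
Qed.

Definition galg_module : gmodule K n :=
  GModule galg_part0 galg_partD galg_partM galg_part_sum galg_part_direct.

Lemma hideal_mcoeff0 (p : P) : p \in (a : idealr _) -> p@_0%MM = 0.
Proof.
move=> pa; apply/eqP/negPn/negP => p0.
have := hideal_homog 0 pa; rewrite pihomogE.
have -> : \sum_(m <- msupp p | mdeg m == 0%N) p@_m *: 'X_[m] = (p@_0%MM)%:MP.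
  rewrite big_mkcond (bigD1_seq 0%MM) ?msupp_uniq ?mcoeff_msupp //= mdeg0 eqxx.
  rewrite big1 ?addr0; first by rewrite mpolyX0 alg_mpolyC.
  by move=> m /negPf ne0; rewrite mdeg_eq0 ne0.
move=> /(idealMr (p@_0%MM)^-1%:MP); rewrite -mpolyCM mulVf // mpolyC1.
by rewrite idealr1.
Qed.

(* The value does not depend on the representative (galg_augE), elements of a
   having zero constant term. *)
Definition galg_aug_fun (x : A) : K := (repr x)@_0%MM.

Lemma galg_aug_funE p : galg_aug_fun (galg_pi p) = p@_0%MM.
Proof.
apply/eqP; rewrite -subr_eq0 -mcoeffB; apply/eqP/hideal_mcoeff0.
by apply/galg_pi_eq; rewrite galg_piK.
Qed.

Fact galg_aug_is_zmod_morphism : zmod_morphism galg_aug_fun.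
Proof.
move=> x y; rewrite -[x]galg_piK -[y]galg_piK -rmorphB !galg_aug_funE.
exact: mcoeffB.
Qed.

Fact galg_aug_is_monoid_morphism : monoid_morphism galg_aug_fun.
Proof.
split=> [|x y]; first by rewrite -(rmorph1 galg_pi) galg_aug_funE mcoeff1 eqxx.
rewrite -[x]galg_piK -[y]galg_piK -rmorphM !galg_aug_funE.
exact: (rmorphM (mcoeff0r K n)).
Qed.

HB.instance Definition _ :=
  GRing.isZmodMorphism.Build A K galg_aug_fun galg_aug_is_zmod_morphism.
HB.instance Definition _ :=
  GRing.isMonoidMorphism.Build A K galg_aug_fun galg_aug_is_monoid_morphism.

Definition galg_aug : {rmorphism A -> K} := galg_aug_fun.

Lemma galg_augE p : galg_aug (galg_pi p) = p@_0%MM.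
Proof. exact: galg_aug_funE. Qed.

Lemma galg_aug_gcomp d x : (0 < d)%N -> galg_aug (gcomp d x) = 0.
Proof. by move=> d0; rewrite galg_augE (homog_mcoeff0 (pihomogP _ _ _)). Qed.

End GradedAlgebra.

Section DirectProduct.
Variables (r : nat) (A : 'I_r -> comPzRingType).

Definition dprod : Type := {dffun forall i, A i}.
HB.instance Definition _ := Choice.on dprod.

Definition dprod_of (f : forall i, A i) : dprod := [ffun i => f i].
Definition dprod_fun (x : dprod) : forall i, A i := fun i => (x : {dffun forall i, A i}) i.

Lemma dprodE f i : dprod_fun (dprod_of f) i = f i.
Proof. exact: ffunE. Qed.

Lemma dprodP x y : (forall i, dprod_fun x i = dprod_fun y i) -> x = y.
Proof. by move=> h; apply/ffunP. Qed.

Definition dprod_add x y := dprod_of (fun i => dprod_fun x i + dprod_fun y i).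
Definition dprod_opp x := dprod_of (fun i => - dprod_fun x i).
Definition dprod_mul x y := dprod_of (fun i => dprod_fun x i * dprod_fun y i).

Fact dprod_addA : associative dprod_add.
Proof. by move=> x y z; apply: dprodP => i; rewrite !dprodE addrA. Qed.
Fact dprod_addC : commutative dprod_add.
Proof. by move=> x y; apply: dprodP => i; rewrite !dprodE addrC. Qed.
Fact dprod_add0 : left_id (dprod_of (fun=> 0)) dprod_add.
Proof. by move=> x; apply: dprodP => i; rewrite !dprodE add0r. Qed.
Fact dprod_addN : left_inverse (dprod_of (fun=> 0)) dprod_opp dprod_add.
Proof. by move=> x; apply: dprodP => i; rewrite !dprodE addNr. Qed.
HB.instance Definition _ :=
  GRing.isZmodule.Build dprod dprod_addA dprod_addC dprod_add0 dprod_addN.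

Fact dprod_mulA : associative dprod_mul.
Proof. by move=> x y z; apply: dprodP => i; rewrite !dprodE mulrA. Qed.
Fact dprod_mulC : commutative dprod_mul.
Proof. by move=> x y; apply: dprodP => i; rewrite !dprodE mulrC. Qed.
Fact dprod_mul1 : left_id (dprod_of (fun=> 1)) dprod_mul.
Proof. by move=> x; apply: dprodP => i; rewrite !dprodE mul1r. Qed.
Fact dprod_mulD : left_distributive dprod_mul dprod_add.
Proof. by move=> x y z; apply: dprodP => i; rewrite !dprodE mulrDl. Qed.
HB.instance Definition _ := GRing.Zmodule_isComPzRing.Build dprod
  dprod_mulA dprod_mulC dprod_mul1 dprod_mulD.

End DirectProduct.

Section FiberProduct.
Variables (K : fieldType) (r : nat) (A : 'I_r -> comPzRingType).
Variable e : forall i, {rmorphism A i -> K}.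

Definition fiber_pred : pred (dprod A) := fun x =>
  [forall i, forall j, e i (dprod_fun x i) == e j (dprod_fun x j)].

Lemma fiberP x :
  reflect (forall i j, e i (dprod_fun x i) = e j (dprod_fun x j)) (fiber_pred x).
Proof.
apply: (iffP forallP) => [h i j|h i]; first by have /forallP/(_ j)/eqP := h i.
by apply/forallP => j; rewrite (h i j).
Qed.

Fact fiber_subring_closed : subring_closed fiber_pred.
Proof.
split=> [|x y /fiberP hx /fiberP hy|x y /fiberP hx /fiberP hy]; apply/fiberP => i j.
- by rewrite !dprodE !rmorph1.
- by rewrite !dprodE !rmorphD !rmorphN (hx i j) (hy i j).
- by rewrite !dprodE !rmorphM (hx i j) (hy i j).
Qed.

HB.instance Definition _ :=
  GRing.isSubringClosed.Build (dprod A) fiber_pred fiber_subring_closed.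

Record fiber : Type := Fiber { fiber_val : dprod A; _ : fiber_val \in fiber_pred }.

HB.instance Definition _ := [isSub for fiber_val].
HB.instance Definition _ := [Choice of fiber by <:].
HB.instance Definition _ := 
  GRing.SubChoice_isSubComPzRing.Build (dprod A) fiber_pred fiber
    fiber_subring_closed.

Definition fiber_coord (x : fiber) (i : 'I_r) : A i := dprod_fun (val x) i.

Lemma fiber_inj x y : (forall i, fiber_coord x i = fiber_coord y i) -> x = y.
Proof. by move=> h; apply/val_inj/dprodP. Qed.

Definition fiber_of f (hf : forall i j, e i (f i) = e j (f j)) : fiber.
Proof.
exists (dprod_of f); apply/fiberP => i j; rewrite !dprodE; exact: hf.
Defined.

Lemma fiber_ofE f hf i : fiber_coord (@fiber_of f hf) i = f i.
Proof. exact: dprodE. Qed.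

Lemma fiber_coordP x i j : e i (fiber_coord x i) = e j (fiber_coord x j).
Proof. by case: x => x hx; exact: (fiberP _ hx). Qed.

Lemma fiber_coord0 i : fiber_coord 0 i = 0.
Proof. exact: dprodE. Qed.
Lemma fiber_coordD x y i : fiber_coord (x + y) i = fiber_coord x i + fiber_coord y i.
Proof. exact: dprodE. Qed.
Lemma fiber_coordN x i : fiber_coord (- x) i = - fiber_coord x i.
Proof. exact: dprodE. Qed.
Lemma fiber_coord1 i : fiber_coord 1 i = 1.
Proof. exact: dprodE. Qed.
Lemma fiber_coordM x y i : fiber_coord (x * y) i = fiber_coord x i * fiber_coord y i.
Proof. exact: dprodE. Qed.
Lemma fiber_coord_sum m (c : nat -> fiber) i :
  fiber_coord (\sum_(d < m) c d) i = \sum_(d < m) fiber_coord (c d) i.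
Proof. exact: (big_morph (fiber_coord^~ i) (fun x y => fiber_coordD x y i) (fiber_coord0 i)). Qed.

End FiberProduct.

Section FiberModule.
Variables (K : fieldType) (r : nat) (n : 'I_r -> nat).
Variable a : forall i, hideal K (n i).

(* Q = R_1 (x)_K ... (x)_K R_r; the variable x_{i,j} is 'X_(tagnat.Rank i j). *)
Local Notation Q := {mpoly K[(\sum_i n i)%N]}.

Definition fiberp : comPzRingType := fiber (fun i => galg_aug (a i)).

(* Q -> R_i sends x_{i,j} to x_{i,j} and the variables of the other factors to 0. *)
Definition tens_proj i : {rmorphism Q -> {mpoly K[n i]}} :=
  mmap (@mpolyC (n i) K)
    (fun k => \sum_(j < n i | tagnat.Rank i j == k) 'X_j).

Lemma tens_projX i m : tens_proj i 'X_[m] =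
  \prod_k (\sum_(j < n i | tagnat.Rank i j == k) 'X_j) ^+ m k.
Proof. by rewrite /= mmapX. Qed.

Lemma tens_projE i p :
  tens_proj i p = \sum_(m <- msupp p) p@_m *: tens_proj i 'X_[m].
Proof.
rewrite [in LHS](mpolyE p) rmorph_sum /=; apply: eq_bigr => m _.
by rewrite -mul_mpolyC rmorphM /= mmapC mul_mpolyC.
Qed.

Lemma tens_proj_homog i p d : p \is d.-homog -> tens_proj i p \is d.-homog.
Proof.
move=> hp; rewrite tens_projE big_seq; apply: rpred_sum => m mp; apply: dhomogZ.
rewrite tens_projX -(dhomogP _ _ _ hp _ mp) /= mdegE.
apply: (big_ind2 (fun (q : {mpoly K[n i]}) e => q \is e.-homog)).
- exact: dhomog1.
- by move=> q1 e1 q2 e2; exact: dhomogM.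
move=> k _; rewrite -[X in X.-homog]mul1n; apply: dhomogMn.
by apply: rpred_sum => j _; rewrite dhomogX /= mdeg1.
Qed.

Lemma tens_proj_mcoeff0 i p : (tens_proj i p)@_0%MM = p@_0%MM.
Proof.
elim/mpolyind: p => [|c m p _ _ IH]; first by rewrite rmorph0 !mcoeff0.
rewrite rmorphD !mcoeffD IH; congr (_ + _).
rewrite -mul_mpolyC rmorphM [tens_proj i c%:MP]mmapC !mul_mpolyC !mcoeffZ.
congr (_ * _); case: (posnP (mdeg m)) => [/eqP|m0].
  by rewrite mdeg_eq0 => /eqP->; rewrite mpolyX0 rmorph1 !mcoeff1 !eqxx.
have hm : ('X_[m] : Q) \is (mdeg m).-homog by rewrite dhomogX.
by rewrite !(homog_mcoeff0 _ m0) // tens_proj_homog.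
Qed.

(* q |-> (tens_proj i q mod a_i)_i, through which Q acts on the fiber product. *)
Definition fiber_pi_fun (q : Q) : fiberp :=
  @fiber_of K r (fun i => galg (a i)) (fun i => galg_aug (a i))
    (fun i => galg_pi (a i) (tens_proj i q))
    (fun i j => etrans (etrans (galg_augE _ _) (tens_proj_mcoeff0 i q))
                  (esym (etrans (galg_augE _ _) (tens_proj_mcoeff0 j q)))).

Lemma fiber_pi_funE q i :
  fiber_coord (fiber_pi_fun q) i = galg_pi (a i) (tens_proj i q).
Proof. exact: fiber_ofE. Qed.

Fact fiber_pi_is_zmod_morphism : zmod_morphism fiber_pi_fun.
Proof.
move=> p q; apply: fiber_inj => i.
by rewrite fiber_coordD fiber_coordN !fiber_pi_funE !rmorphB.
Qed.

Fact fiber_pi_is_monoid_morphism : monoid_morphism fiber_pi_fun.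
Proof.
split=> [|p q]; apply: fiber_inj => i.
  by rewrite fiber_coord1 fiber_pi_funE !rmorph1.
by rewrite fiber_coordM !fiber_pi_funE !rmorphM.
Qed.

HB.instance Definition _ :=
  GRing.isZmodMorphism.Build Q fiberp fiber_pi_fun fiber_pi_is_zmod_morphism.
HB.instance Definition _ :=
  GRing.isMonoidMorphism.Build Q fiberp fiber_pi_fun fiber_pi_is_monoid_morphism.

Definition fiber_pi : {rmorphism Q -> fiberp} := fiber_pi_fun.

Definition fiber_part (d : nat) (x : resmod fiber_pi) : Prop :=
  forall i, galg_part d (fiber_coord (x : fiberp) i).

Fact fiber_part0 d : fiber_part d 0.
Proof. by move=> i; rewrite fiber_coord0; exact: galg_part0. Qed.

Fact fiber_partD d x y : fiber_part d x -> fiber_part d y -> fiber_part d (x + y).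
Proof. by move=> hx hy i; rewrite fiber_coordD; exact: galg_partD. Qed.

Fact fiber_partM d e (p : Q) x :
  p \is d.-homog -> fiber_part e x -> fiber_part (d + e) (p *: x).
Proof.
move=> hp hx i; rewrite fiber_coordM fiber_pi_funE.
by apply: (galg_partM (tens_proj_homog i hp) (hx i)).
Qed.

Lemma fiber_comp_compat d (x : fiberp) i j :
  galg_aug (a i) (gcomp d (fiber_coord x i)) =
  galg_aug (a j) (gcomp d (fiber_coord x j)).
Proof.
case: d => [|d]; last by rewrite !galg_aug_gcomp.
suff aug0 k (y : galg (a k)) : galg_aug (a k) (gcomp 0 y) = galg_aug (a k) y.
  by rewrite !aug0; exact: (@fiber_coordP K r _ (fun i => galg_aug (a i)) x).
rewrite [y in RHS](gcomp_partition (leqnSn _)) big_ord_recl rmorphD rmorph_sum.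
by rewrite big1 ?addr0 // => l _; rewrite /= galg_aug_gcomp.
Qed.

Fact fiber_part_sum (x : resmod fiber_pi) :
  exists m (c : nat -> resmod fiber_pi),
    (forall d, fiber_part d (c d)) /\ x = \sum_(d < m) c d.
Proof.
exists (\max_i msize (repr (fiber_coord (x : fiberp) i))).
pose c d : fiberp := fiber_of (@fiber_comp_compat d x).
exists c; split=> [d i|].
  by rewrite fiber_ofE; exact: gcomp_part.
apply: fiber_inj => i; apply: (etrans _ (esym (fiber_coord_sum _ c i))).
rewrite [LHS](@gcomp_partition _ _ _ (\max_i msize (repr (fiber_coord (x : fiberp) i)))).
  by apply: eq_bigr => d _; rewrite fiber_ofE.
exact: (leq_bigmax (F := fun i => msize (repr (fiber_coord (x : fiberp) i)))).
Qed.

Fact fiber_part_direct m (c : nat -> resmod fiber_pi) :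
  (forall d, fiber_part d (c d)) ->
  \sum_(d < m) c d = 0 -> forall d, (d < m)%N -> c d = 0.
Proof.
move=> hc s0 d dm; apply: fiber_inj => i; rewrite fiber_coord0.
apply: (@galg_part_direct _ _ _ m (fun d => fiber_coord (c d : fiberp) i)) => //.
  by move=> e; exact: hc.
have E : fiber_coord (\sum_(d < m) c d : fiberp) i =
    \sum_(d < m) fiber_coord (c d : fiberp) i by exact: fiber_coord_sum.
by rewrite s0 fiber_coord0 in E; apply: (etrans (esym E)).
Qed.

Definition fiber_module : gmodule K (\sum_i n i)%N :=
  GModule fiber_part0 fiber_partD fiber_partM fiber_part_sum fiber_part_direct.

End FiberModule.

(* Membership in the square of the irrelevant ideal (x_1, ..., x_n), the ideal
   generated by the products x_j x_k. *)
Definition in_irr2 (K : fieldType) (n : nat) (p : {mpoly K[n]}) : Prop :=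
  exists q : 'I_n -> 'I_n -> {mpoly K[n]},
    p = \sum_j \sum_k q j k * ('X_j * 'X_k).

(* f i j is the coefficient of t^i s^j. *)
Definition series := nat -> nat -> int.

Definition poincare (K : fieldType) (n : nat) (M : gmodule K n) : series :=
  fun i j => (tor_dim M (resfield K n) i j)%:Z.

Definition series_sub (f g : series) : series := fun i j => f i j - g i j.
Definition series_mul (f g : series) : series := fun i j =>
  \sum_(k < i.+1) \sum_(l < j.+1) f k l * g (i - k)%N (j - l)%N.

(* Polynomials in t over Z[s]. *)
Definition tvar : {poly {poly int}} := 'X.
Definition svar : {poly {poly int}} := 'X%:P.
Definition series_of (p : {poly {poly int}}) : series := fun i j => p`_i`_j.

(* p / t, exact when the constant coefficient of p in t is zero. *)
Definition divt (p : {poly {poly int}}) : {poly {poly int}} := drop_poly 1 p.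

Lemma divtK (p : {poly {poly int}}) : p`_0 = 0 -> divt p * tvar = p.
Proof.
move=> p0; apply/polyP => -[|i]; first by rewrite coefMX p0.
by rewrite coefMX coef_drop_poly addn1.
Qed.

(* Main.v *)
Require Import Defs.
From Stdlib Require Import Classical ClassicalEpsilon.
From HB Require Import structures.
From mathcomp Require Import all_boot all_order all_algebra.
From mathcomp Require Import ring_quotient mpoly.

(** Tor against the residue field is the homology of the Koszul complex.
    A chain of homological degree [u] assigns to each [u]-element set [S] of
    variables a coefficient of the wedge of [S]; the strand of internal
    degree [u + e] is the one with coefficients of degree [e]. All dimensions
    are therefore determined by the dimensions of the spaces of chains and of
    cycles in each bidegree ([tor_dim_count]).

    In degrees [e > 0] the fiber product is the direct product of the [A_i], and
    a variable of the j-th ring acts as zero on [A_i] when [j] differs from [i].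
    Hence the chains with coefficients of positive degree split, compatibly with
    the differential, into pieces indexed by a factor [i] and a set [T] of
    variables outside the i-th ring; the piece of [(i, T)] is the Koszul complex
    of [A_i] over [R_i], shifted by the cardinal of [T] ([strand],
    [strand_kdif]). There are as many sets [T] with [k] elements as the
    coefficient of [(s t)^k] in [(1 + s t)^(N - n_i)], which is the source of
    this factor.

    For [e >= 2] only such chains matter, and the Betti numbers of the fiber
    product are those convolutions ([betti_fiber2]). For [e = 1] the cycles still
    split, but the boundaries come from chains with coefficients in the
    degree-zero part, which is a single copy of [K] for the fiber product and one
    copy for each of the [A_i]. Since the ideals contain no linear forms, the
    differential is injective on these chains in positive homological
    degree ([vdim_kcycle_linear]), so the discrepancy is a sum of binomial
    coefficients, evaluated with the Vandermonde identity ([betti_fiber1]). This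
    is the part of the formula divided by [t]. For [e = 0] the same injectivity
    leaves only the constant [1].

    The frame for this computation is the following. The Koszul complex resolves
    the residue field ([koszul_resolution]): an explicit contraction divides by
    the least variable that occurs ([khom_homotopy]). Graded chain
    maps lifting the identity of a module are unique up to homotopy, so the
    homology does not depend on the resolution ([tor_independent]). *)

Set Implicit Arguments.
Unset Strict Implicit.
Unset Printing Implicit Defensive.

Import GRing.Theory.
Local Open Scope ring_scope.

(** * Dimensions of subquotients *)

Section Dimension.
Variable K : fieldType.
Implicit Types (W : lmodType K) (m p : nat).

Definition subspace W (Z : W -> Prop) : Prop :=
  Z 0 /\ forall a x y, Z x -> Z y -> Z (a *: x + y).

Definition independent_mod W (B : W -> Prop) m (e : 'I_m -> W) : Prop :=
  forall c : 'I_m -> K, B (\sum_k c k *: e k) -> forall k, c k = 0.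

Definition spans_mod W (Z B : W -> Prop) m (e : 'I_m -> W) : Prop :=
  forall v, Z v -> exists c : 'I_m -> K, B (v - \sum_k c k *: e k).

(** The dimension of [Z / B] is a relation rather than a function: it makes sense
    for arbitrary predicates and presupposes no finiteness. *)
Definition qdim W (Z B : W -> Prop) m : Prop :=
  exists e : 'I_m -> W,
    [/\ forall k, Z (e k), spans_mod Z B e & independent_mod B e].

Definition zerosp W (v : W) : Prop := v = 0.
Definition vdim W (Z : W -> Prop) m : Prop := qdim Z (@zerosp W) m.

Lemma zerosp_subspace W : subspace (@zerosp W).
Proof. by split=> // a x y -> ->; rewrite scaler0 addr0. Qed.

Section Subspace.
Variables (W : lmodType K) (Z : W -> Prop).
Hypothesis sZ : subspace Z.

Lemma subspaceZ a x : Z x -> Z (a *: x).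
Proof. by case: sZ => Z0 ZD Zx; rewrite -[_ *: _]addr0; apply: ZD. Qed.

Lemma subspaceD x y : Z x -> Z y -> Z (x + y).
Proof. by case: sZ => Z0 ZD Zx Zy; rewrite -[x]scale1r; apply: ZD. Qed.

Lemma subspaceN x : Z x -> Z (- x).
Proof. by move=> Zx; rewrite -scaleN1r; apply: subspaceZ. Qed.

Lemma subspaceB x y : Z x -> Z y -> Z (x - y).
Proof. by move=> Zx Zy; apply/subspaceD/subspaceN. Qed.

Lemma subspace_sum (I : Type) (s : seq I) (P : pred I) (f : I -> W) :
  (forall i, P i -> Z (f i)) -> Z (\sum_(i <- s | P i) f i).
Proof.
move=> Zf; apply: (big_ind Z) => //; first by case: sZ.
exact: subspaceD.
Qed.

End Subspace.

Lemma linear_zero W W' (f : W -> W') : linear f -> f 0 = 0.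
Proof. by move=> lf; have := lf (-1) 0 0; rewrite scaler0 add0r scaleN1r addNr. Qed.

Lemma linear_comb W W' (f : W -> W') (I : finType) (c : I -> K) (e : I -> W) :
  linear f -> f (\sum_k c k *: e k) = \sum_k c k *: f (e k).
Proof.
move=> lf; have f0 := linear_zero lf.
elim/big_rec2: _ => //= i y x _ <-; exact: lf.
Qed.

(** More unknowns than equations: the coordinates of the [p] vectors form a
    matrix with more rows than columns, and a vector in its left kernel is a
    relation. *)
Lemma independent_le_span W (Z B : W -> Prop) m p (e : 'I_m -> W) (e' : 'I_p -> W) :
  subspace B -> spans_mod Z B e ->
  (forall k, Z (e' k)) -> independent_mod B e' -> (p <= m)%N.
Proof.
move=> sB se Ze' ie'; rewrite leqNgt; apply/negP => mp.
have /fin_all_exists[c hc] k : exists c : 'I_m -> K, B (e' k - \sum_l c l *: e l).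
  exact: se (Ze' k).
pose A := \matrix_(k < p, l < m) c k l.
have : kermx A != 0.
  by rewrite kermx_eq0 /row_free neq_ltn (leq_ltn_trans (rank_leq_col A) mp).
case/rowV0Pn => x /sub_kermxP xA x0; case/negP: x0; apply/eqP/rowP => k.
rewrite mxE; apply: (ie' (fun k => x 0 k)).
have -> : \sum_k x 0 k *: e' k = \sum_k x 0 k *: (e' k - \sum_l c k l *: e l).
  apply/esym/eqP; rewrite -subr_eq0; under eq_bigr do rewrite scalerBr.
  rewrite sumrB addrAC subrr sub0r oppr_eq0.
  under eq_bigr do (rewrite scaler_sumr; under eq_bigr do rewrite scalerA).
  rewrite exchange_big big1 //= => l _; rewrite -scaler_suml.
  have /rowP/(_ l) := xA; rewrite !mxE.
  by under eq_bigr do rewrite mxE; move=> ->; rewrite scale0r.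
by apply: subspace_sum => // i _; apply: subspaceZ.
Qed.

Lemma qdim_uniq W (Z B : W -> Prop) m p :
  subspace B -> qdim Z B m -> qdim Z B p -> m = p.
Proof.
move=> sB [e [Ze se ie]] [e' [Ze' se' ie']]; apply/eqP; rewrite eqn_leq.
by rewrite (independent_le_span sB se' Ze ie) (independent_le_span sB se Ze' ie').
Qed.

(** A maximal independent family spans. *)
Lemma qdim_of_bound W (Z B : W -> Prop) m :
  subspace Z -> subspace B ->
  (forall p (e : 'I_p -> W),
     (forall k, Z (e k)) -> independent_mod B e -> (p <= m)%N) ->
  exists2 k, (k <= m)%N & qdim Z B k.
Proof.
move=> sZ sB bound.
pose P p := exists e : 'I_p -> W, (forall k, Z (e k)) /\ independent_mod B e.
have [p [Pp nPp]] : exists p, P p /\ ~ P p.+1.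
  apply: NNPP => nex.
  have allP p : P p.
    elim: p => [|p Pp]; first by exists (fun=> 0); split => [[]|c _ []].
    by apply: NNPP => nPp; apply: nex; exists p.
  by have [e [Ze ie]] := allP m.+1; have := bound _ _ Ze ie; rewrite ltnn.
case: Pp => e [Ze ie]; exists p; first exact: bound Ze ie.
exists e; split=> // v Zv; apply: NNPP => nspan; apply: nPp.
exists (fun k => if unlift ord0 k is Some j then e j else v); split=> [k|c].
  by case: unliftP.
rewrite big_ord_recl unlift_none; under eq_bigr do rewrite liftK.
move=> Bc; have c0 : c ord0 = 0.
  apply: NNPP => /eqP c0; apply: nspan.
  exists (fun j => - (c ord0)^-1 * c (lift ord0 j)).
  have := subspaceZ sB (c ord0)^-1 Bc.
  rewrite scalerDr scalerA mulVf // scale1r scaler_sumr -sumrN.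
  congr (B (_ + _)); apply: eq_bigr => j _.
  by rewrite mulNr scaleNr opprK scalerA.
move=> k; case: (unliftP ord0 k) => [j|] -> //.
by apply: (ie (fun j => c (lift ord0 j))); move: Bc; rewrite c0 scale0r add0r.
Qed.

Lemma qdim_of_span W (Z B : W -> Prop) m (e : 'I_m -> W) :
  subspace Z -> subspace B -> spans_mod Z B e ->
  exists2 k, (k <= m)%N & qdim Z B k.
Proof.
move=> sZ sB se; apply: qdim_of_bound => // p e' Ze' ie'.
exact: independent_le_span se Ze' ie'.
Qed.

Lemma qdim_sub W (Z Z' B : W -> Prop) m :
  subspace Z' -> subspace B -> (forall x, Z' x -> Z x) -> qdim Z B m ->
  exists2 k, (k <= m)%N & qdim Z' B k.
Proof.
move=> sZ' sB sub [e [Ze se ie]]; apply: (qdim_of_span (e := e)) => //.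
by move=> v /sub/se.
Qed.

Lemma qdim_quo W (Z B B' : W -> Prop) m :
  subspace Z -> subspace B' -> (forall x, B x -> B' x) -> qdim Z B m ->
  exists2 k, (k <= m)%N & qdim Z B' k.
Proof.
move=> sZ sB' sub [e [Ze se ie]]; apply: (qdim_of_span (e := e)) => //.
by move=> v /se[c Bc]; exists c; apply: sub.
Qed.

(** A basis of [Y] modulo [B] followed by a basis of [Z] modulo [Y] is a basis of
    [Z] modulo [B]. *)
Lemma qdim_add W (Z Y B : W -> Prop) m p :
  subspace Z -> subspace Y -> subspace B ->
  (forall x, B x -> Y x) -> (forall x, Y x -> Z x) ->
  qdim Y B m -> qdim Z Y p -> qdim Z B (m + p)%N.
Proof.
move=> sZ sY sB BY YZ [e [Ye se ie]] [f [Zf sf if_]].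
pose g k := match split k with inl i => e i | inr j => f j end.
have gl i : g (lshift p i) = e i.
  by rewrite /g -[lshift p i]/(unsplit (inl i)) unsplitK.
have gr j : g (rshift m j) = f j.
  by rewrite /g -[rshift m j]/(unsplit (inr j)) unsplitK.
have sumg c : \sum_k c k *: g k =
    \sum_i c (lshift p i) *: e i + \sum_j c (rshift m j) *: f j.
  by rewrite big_split_ord /=; congr (_ + _); apply: eq_bigr => i _; rewrite ?gl ?gr.
exists g; split=> [k|v Zv|c].
- by rewrite /g; case: (split k) => i; [apply/YZ/Ye|apply: Zf].
- have [d Yd] := sf v Zv; have [c Bc] := se _ Yd.
  exists (fun k => match split k with inl i => c i | inr j => d j end).
  rewrite sumg [X in v - X]addrC opprD addrA.
  suff [-> ->] : \sum_j
        match split (rshift m j) with inl i => c i | inr j => d j end *: f j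
      = \sum_j d j *: f j /\
    \sum_i match split (lshift p i) with inl i => c i | inr j => d j end *: e i
      = \sum_i c i *: e i by [].
  split; apply: eq_bigr => i _; congr (_ *: _).
    by rewrite -[rshift m i]/(unsplit (inr i)) unsplitK.
  by rewrite -[lshift p i]/(unsplit (inl i)) unsplitK.
- rewrite sumg => Bc.
  have d0 j : c (rshift m j) = 0.
    apply: (if_ (fun j => c (rshift m j))); have := BY _ Bc.
    have Ys : Y (\sum_i c (lshift p i) *: e i).
      by apply: subspace_sum => // i _; apply: subspaceZ.
    by move=> /(subspaceB sY)/(_ Ys); rewrite addrAC subrr add0r.
  move=> k; rewrite -[k]splitK; case: (split k) => i /=; last exact: d0.
  apply: (ie (fun i => c (lshift p i))); move: Bc.
  by rewrite [X in _ + X]big1 ?addr0 // => j _; rewrite d0 scale0r.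
Qed.

(** The quotient has some dimension because a spanning family of [Z] spans it;
    additivity then determines that dimension. *)
Lemma qdim_sub_quo W (Z B : W -> Prop) z b :
  subspace Z -> subspace B -> (forall x, B x -> Z x) ->
  vdim Z z -> vdim B b -> (b <= z)%N /\ qdim Z B (z - b).
Proof.
move=> sZ sB BZ dZ dB; have s0 := zerosp_subspace W.
have B0 x : zerosp x -> B x by move->; case: sB.
have [q _ dq] := qdim_quo sZ sB B0 dZ.
have /(qdim_uniq s0 dZ) -> := qdim_add sZ sB s0 B0 BZ dB dq.
by rewrite leq_addr addKn.
Qed.

Definition image W W' (f : W -> W') (Z : W -> Prop) (y : W') : Prop :=
  exists2 x, Z x & f x = y.

Lemma image_subspace W W' (f : W -> W') (Z : W -> Prop) :
  linear f -> subspace Z -> subspace (image f Z).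
Proof.
move=> lf sZ; split=> [|a _ _ [x Zx <-] [y Zy <-]].
  by exists 0; [case: sZ|exact: linear_zero].
by exists (a *: x + y); [case: sZ => _; apply|rewrite lf].
Qed.

Lemma kernel_subspace W W' (f : W -> W') (Z : W -> Prop) :
  linear f -> subspace Z -> subspace (fun x => Z x /\ f x = 0).
Proof.
move=> lf sZ; split=> [|a x y [Zx fx] [Zy fy]].
  by split; [case: sZ|exact: linear_zero].
by split; [case: sZ => _; apply|rewrite lf fx fy scaler0 addr0].
Qed.

Lemma linearB W W' (f : W -> W') x y : linear f -> f (x - y) = f x - f y.
Proof. by move=> lf; rewrite -scaleN1r addrC lf scaleN1r addrC. Qed.

(** Rank-nullity: [f] identifies the quotient of [Z] by the kernel with the
    image. *)
Lemma vdim_image W W' (f : W -> W') (Z : W -> Prop) z k :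
  linear f -> subspace Z -> vdim Z z -> vdim (fun x => Z x /\ f x = 0) k ->
  (k <= z)%N /\ vdim (image f Z) (z - k).
Proof.
move=> lf sZ dZ dk; have sk := kernel_subspace lf sZ.
have [-> [e [Ze se ie]]] := qdim_sub_quo sZ sk (fun x => @proj1 _ _) dZ dk.
split=> //; exists (f \o e); split=> [i|_ [x Zx <-]|c] /=.
- by exists (e i).
- have [c [_ fc]] := se x Zx; exists c; move: fc.
  by rewrite linearB // linear_comb.
- rewrite -linear_comb // => fc; apply: ie; split=> //.
  by apply: subspace_sum => // i _; apply: subspaceZ.
Qed.

Lemma qdim_fintype W (Z B : W -> Prop) (I : finType) (e : I -> W) :
  (forall k, Z (e k)) ->
  (forall v, Z v -> exists c : I -> K, B (v - \sum_k c k *: e k)) ->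
  (forall c : I -> K, B (\sum_k c k *: e k) -> forall k, c k = 0) ->
  qdim Z B #|I|.
Proof.
have sumE (c : I -> K) : \sum_k c k *: e k =
  \sum_(i < #|I|) c (enum_val i) *: e (enum_val i).
  by rewrite -(big_enum_val (A := I) (fun k => c k *: e k)).
move=> Ze se ie; exists (fun i => e (enum_val i)); split=> [i|v Zv|c Bc k].
- exact: Ze.
- by have [c] := se v Zv; rewrite sumE; exists (fun i => c (enum_val i)).
- have := ie (fun i => c (enum_rank i)); rewrite sumE.
  under eq_bigr do rewrite enum_valK.
  by move=> /(_ Bc (enum_val k)); rewrite enum_valK.
Qed.

(** The dimension of a direct product, the product being presented by its
    projections so that no type of dependent families is needed. *)
Lemma vdim_product W (Z : W -> Prop) (I : finType) (U : I -> lmodType K)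
    (Y : forall i, U i -> Prop) (p : forall i, W -> U i) (m : I -> nat) :
  subspace Z -> (forall i, linear (p i)) ->
  (forall w, Z w -> forall i, Y i (p i w)) ->
  (forall w, Z w -> (forall i, p i w = 0) -> w = 0) ->
  (forall y : forall i, U i, (forall i, Y i (y i)) ->
     exists2 w, Z w & forall i, p i w = y i) ->
  (forall i, subspace (Y i)) ->
  (forall i, vdim (Y i) (m i)) -> vdim Z (\sum_i m i)%N.
Proof.
move=> sZ lp pY inj surj sY dY.
have [e he] : exists e : forall i, 'I_(m i) -> U i, forall i,
    [/\ forall k, Y i (e i k), spans_mod (Y i) (@zerosp (U i)) (e i)
      & independent_mod (@zerosp (U i)) (e i)].
  exists (fun i => proj1_sig (constructive_indefinite_description _ (dY i))) => i.
  by case: constructive_indefinite_description.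
pose J := {i : I & 'I_(m i)}.
(* The family with a single nonzero component, a basis vector; the match
   transports its index along [tag j = i]. *)
pose y (j : J) i : U i :=
  match eqVneq (tag j) i with
  | EqNotNeq E => e i (eq_rect (tag j) (fun i => 'I_(m i)) (tagged j) i E)
  | _ => 0
  end.
have yY j i : Y i (y j i).
  rewrite /y; case: eqVneq => [E|_]; last by case: (sY i).
  by case: (he i) => Ye _ _.
have yS i k : y (Tagged (fun i => 'I_(m i)) k) i = e i k.
  rewrite /y; case: eqVneq => [/= E|/=]; last by rewrite eqxx.
  by rewrite (eq_irrelevance E erefl).
have yD i j : tag j != i -> y j i = 0.
  by rewrite /y; case: eqVneq.
have /fin_all_exists2[b bZ bp] (j : J) : exists2 w, Z w & forall i, p i w = y j i.
  exact: surj (yY j).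
have pb (c : J -> K) i : p i (\sum_j c j *: b j) =
    \sum_(k < m i) c (Tagged (fun i => 'I_(m i)) k) *: e i k.
  rewrite linear_comb //.
  transitivity (\sum_i' \sum_(k < m i') c (Tagged (fun i => 'I_(m i)) k) *:
       y (Tagged (fun i => 'I_(m i)) k) i).
    rewrite sig_big_dep /=; apply: eq_bigr => -[i' k] _ /=.
    by rewrite bp.
  rewrite (bigD1 i) //= [X in _ + X]big1 ?addr0.
    by apply: eq_bigr => k _; rewrite yS.
  by move=> i' ne; rewrite big1 // => k _; rewrite yD ?scaler0.
have <- : #|{: J}| = (\sum_i m i)%N.
  by rewrite card_tagged sumnE big_map big_enum; apply: eq_bigr => i _;
    rewrite card_ord.
apply: (qdim_fintype (e := b)) => // [v Zv|c bc0 [i k]].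
- have hc i : exists c : 'I_(m i) -> K, zerosp (p i v - \sum_k c k *: e i k).
    by case: (he i) => _ se _; apply/se/pY.
  pose c i := proj1_sig (constructive_indefinite_description _ (hc i)).
  exists (fun j => c (tag j) (tagged j)); apply: inj.
    by apply: subspaceB => //; apply: subspace_sum => // j _; apply: subspaceZ.
  move=> i; rewrite linearB // pb /= /c.
  by case: constructive_indefinite_description.
- case: (he i) => _ _ ie; apply: (ie (fun k => c (Tagged _ k))).
  by rewrite /zerosp -pb bc0 linear_zero.
Qed.

Lemma vdim0 W (Z : W -> Prop) : (forall x, Z x -> x = 0) -> vdim Z 0.
Proof.
move=> Z0; exists (fun=> 0); split=> [[]//|v /Z0 ->|c _ []//].
by exists (fun=> 0); rewrite big_ord0 subrr.
Qed.

Lemma qdim_ext W (Z Z' B B' : W -> Prop) m :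
  (forall x, Z x <-> Z' x) -> (forall x, B x <-> B' x) ->
  qdim Z B m -> qdim Z' B' m.
Proof.
move=> ZZ BB [e [Ze se ie]]; exists e; split=> [k|v /ZZ/se[c]|c /BB/ie//].
  exact/ZZ.
by move/BB; exists c.
Qed.

(** Maps inverse to each other modulo [B] and [B'] identify the subquotients. *)
Lemma qdim_transfer W W' (Z B : W -> Prop) (Z' B' : W' -> Prop)
    (f : W -> W') (g : W' -> W) m :
  linear f -> linear g -> subspace Z -> subspace B -> subspace B' ->
  (forall x, Z x -> Z' (f x)) -> (forall x, B x -> B' (f x)) ->
  (forall y, Z' y -> Z (g y)) -> (forall y, B' y -> B (g y)) ->
  (forall x, Z x -> B (g (f x) - x)) -> (forall y, Z' y -> B' (f (g y) - y)) ->
  qdim Z B m -> qdim Z' B' m.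
Proof.
move=> lf lg sZ sB sB' fZ fB gZ gB gf fg [e [Ze se ie]].
exists (f \o e); split=> [k|y Zy|c Bc] /=; first exact: fZ.
  have [c Bc] := se _ (gZ _ Zy); exists c.
  have := subspaceB sB' (fB _ Bc) (fg y Zy).
  by rewrite linearB // linear_comb // opprB addrC addrA subrK.
apply: ie; set x := \sum_k _.
have Zx : Z x by apply: subspace_sum => // i _; apply: subspaceZ.
have := subspaceB sB (gB _ Bc) (gf x Zx).
by rewrite -linear_comb // opprB addrC subrK.
Qed.

End Dimension.

(** * Independence of the resolution *)

Lemma dependent_choice (T : nat -> Type) (G : forall i, T i -> Prop)
    (R : forall i, T i -> T i.+1 -> Prop) :
  (exists x, G 0%N x) ->
  (forall i x, G i x -> exists y, G i.+1 y /\ R i x y) ->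
  exists f : forall i, T i, forall i, G i (f i) /\ R i (f i) (f i.+1).
Proof.
move=> ex0 exS; have [x0 Gx0] := ex0.
have step i (x : {x | G i x}) :
    {y : {y | G i.+1 y} | R i (proj1_sig x) (proj1_sig y)}.
  apply: constructive_indefinite_description; case: x => x Gx /=.
  by have [y [Gy Rxy]] := exS i x Gx; exists (exist _ y Gy).
pose f := fix f i : {x | G i x} :=
  if i is i'.+1 then proj1_sig (step i' (f i')) else exist _ x0 Gx0.
exists (fun i => proj1_sig (f i)) => i; split; first exact: proj2_sig (f i).
exact: proj2_sig (step i (f i)).
Qed.

Section Scalars.
Variables (K : fieldType) (n : nat).

(** Restriction of scalars to the ground field. *)
Definition kres (V : lmodType {mpoly K[n]}) : Type := V.

Section KRes.
Variable V : lmodType {mpoly K[n]}.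

HB.instance Definition _ := GRing.Zmodule.copy (kres V) V.

Definition kres_scale (c : K) (v : kres V) : kres V := c%:MP_[n] *: (v : V).

Fact kres_scaleA a b v : kres_scale a (kres_scale b v) = kres_scale (a * b) v.
Proof. by rewrite /kres_scale scalerA mpolyCM. Qed.
Fact kres_scale1 : left_id 1 kres_scale.
Proof. by move=> v; rewrite /kres_scale mpolyC1 scale1r. Qed.
Fact kres_scaleDr : right_distributive kres_scale +%R.
Proof. by move=> c u v; rewrite /kres_scale scalerDr. Qed.
Fact kres_scaleDl v : {morph kres_scale^~ v : a b / a + b}.
Proof. by move=> a b; rewrite /kres_scale mpolyCD scalerDl. Qed.

HB.instance Definition _ := GRing.Zmodule_isLmodule.Build K (kres V)
  kres_scaleA kres_scale1 kres_scaleDr kres_scaleDl.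

Lemma kres_scaleE (c : K) (v : kres V) : c *: v = (c%:MP_[n] *: (v : V) : V).
Proof. by []. Qed.

(** The two sides are convertible; stating it lets the theory above apply to
    modules over the polynomial ring. *)
Lemma has_dim_quotE (Z B : V -> Prop) m :
  has_dim_quot Z B m <-> @qdim K (kres V) Z B m.
Proof. by []. Qed.

End KRes.

Lemma kres_linear (V W : lmodType {mpoly K[n]}) (f : V -> W) :
  linear f -> linear (f : kres V -> kres W).
Proof. by move=> lf a u v; apply: lf. Qed.

Lemma dim_quot_eq (V : lmodType {mpoly K[n]}) (Z B : V -> Prop) m :
  subspace (B : kres V -> Prop) -> has_dim_quot Z B m -> dim_quot Z B = m.
Proof.
move=> sB h; apply: (@qdim_uniq K (kres V) Z B) => //.
by apply: (epsilon_spec (inhabits 0%N) (has_dim_quot Z B)); exists m.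
Qed.

End Scalars.

Section Homogeneous.
Variables (K : fieldType) (n : nat).
Local Notation P := {mpoly K[n]}.

(** Multiplication by a form of degree [e] shifts homogeneous components. *)
Lemma pihomogMr (p D : P) d e : D \is e.-homog ->
  pihomog mdeg d (p * D) =
  if (e <= d)%N then pihomog mdeg (d - e) p * D else 0.
Proof.
move=> hD; pose N := maxn (msize p) d.+1.
rewrite {1}(@pihomog_partitionE _ _ mdeg N p) ?leq_maxl //.
rewrite mulr_suml raddf_sum /=.
have E (i : 'I_N) : pihomog mdeg d (pihomog mdeg i p * D) =
    if (i + e == d)%N then pihomog mdeg i p * D else 0.
  have h : pihomog mdeg i p * D \is (i + e).-homog.
    by apply: dhomogM => //; apply: pihomogP.
  by case: eqP => [<-|/eqP ne]; rewrite ?(pihomog_dE h) // (pihomog_ne0 ne h).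
rewrite (eq_bigr _ (fun i _ => E i)) -big_mkcond /=.
case: leqP => ed.
  have dN : (d - e < N)%N by rewrite leq_max ltnS leq_subr orbT.
  rewrite (big_pred1 (Ordinal dN)) // => i /=.
  by rewrite -val_eqE /= -{1}(subnK ed) eqn_add2r.
rewrite big_pred0 // => i; apply/negP => /eqP di.
by move: ed; rewrite -di ltnNge leq_addl.
Qed.

(** Matrices of degree-preserving maps between graded free modules with
    generators in degrees [a] and [b]. *)
Definition hmx p q (a : 'I_p -> nat) (b : 'I_q -> nat) (A : 'M[P]_(p, q)) : Prop :=
  forall k l, if (b l <= a k)%N then is_true (A k l \is (a k - b l).-homog)
    else A k l = 0.

(** The degree-preserving part of a matrix. *)
Definition hproj p q (a : 'I_p -> nat) (b : 'I_q -> nat) (A : 'M[P]_(p, q)) :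
    'M[P]_(p, q) :=
  \matrix_(k, l) if (b l <= a k)%N then pihomog mdeg (a k - b l) (A k l) else 0.

Lemma hproj_hmx p q a b (A : 'M_(p, q)) : hmx a b (hproj a b A).
Proof. by move=> k l; rewrite mxE; case: leqP => // _; apply: pihomogP. Qed.

Lemma hproj_id p q a b (A : 'M_(p, q)) : hmx a b A -> hproj a b A = A.
Proof.
move=> hA; apply/matrixP => k l; rewrite mxE; have := hA k l.
by case: ifP => // _ /pihomog_dE.
Qed.

Lemma hproj_mul p q s a b c (A : 'M_(p, q)) (D : 'M_(q, s)) :
  hmx b c D -> hproj a c (A *m D) = hproj a b A *m D.
Proof.
move=> hD; apply/matrixP => k l; rewrite !mxE raddf_sum /=.
transitivity (\sum_j if (c l <= a k)%N then pihomog mdeg (a k - c l) (A k j * D j l)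
  else 0).
  by case: ifP => //; rewrite big1.
apply: eq_bigr => j _; rewrite !mxE; have := hD j l.
case: (leqP (c l) (b j)) => [cb hjl|_ ->]; last by rewrite !mulr0 raddf0 if_same.
case: (leqP (c l) (a k)) => [ca|ac].
  rewrite (pihomogMr _ _ hjl) leq_sub2rE //; case: leqP => ba; last by rewrite mul0r.
  by rewrite subnBA // subnK.
by rewrite leqNgt (leq_trans ac cb) mul0r.
Qed.

Lemma hmx_mul p q s a b c (A : 'M_(p, q)) (D : 'M_(q, s)) :
  hmx a b A -> hmx b c D -> hmx a c (A *m D).
Proof.
by move=> hA hD; rewrite -(hproj_id hA) -(hproj_mul _ _ hD); apply: hproj_hmx.
Qed.

Lemma hmxB p q a b (A B : 'M_(p, q)) : hmx a b A -> hmx a b B -> hmx a b (A - B).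
Proof.
move=> hA hB k l; have := hA k l; have := hB k l; rewrite !mxE.
by case: ifP => [_ h1 h2|_ -> ->]; rewrite ?subrr ?rpredB.
Qed.

Lemma hmx1 p a : hmx a a (1%:M : 'M_p).
Proof.
move=> k l; rewrite mxE; case: eqVneq => [->|_]; last by case: ifP; rewrite ?rpred0.
by rewrite leqnn subnn dhomog1.
Qed.

(** A homogeneous system solvable row by row is solvable by a homogeneous
    matrix: project any solution. *)
Lemma hmx_lift p q s a b c (A : 'M_(p, s)) (D : 'M_(q, s)) :
  hmx b c D -> hmx a c A -> (forall k, exists w : 'rV_q, row k A = w *m D) ->
  exists B, hmx a b B /\ B *m D = A.
Proof.
move=> hD hA /fin_all_exists[w hw].
exists (hproj a b (\matrix_k w k)); split; first exact: hproj_hmx.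
rewrite -(hproj_mul _ _ hD) -[RHS](hproj_id hA); congr hproj.
by apply/row_matrixP => k; rewrite row_mul rowK hw.
Qed.

End Homogeneous.

Arguments rk {K n N} _ _.
Arguments sh {K n N} _ _ _.
Arguments dif {K n N} _ _.
Arguments aug {K n N} _ _.
Arguments augmap {K n N} _ _.

Section Comparison.
Variables (K : fieldType) (n : nat) (N : gmodule K n).
Local Notation P := {mpoly K[n]}.
Implicit Types F G : free_seq N.

Lemma augmap_linear F a u v : augmap F (a *: u + v) = a *: augmap F u + augmap F v.
Proof.
rewrite /augmap scaler_sumr -big_split; apply: eq_bigr => k _ /=.
by rewrite !mxE scalerDl scalerA.
Qed.

Lemma augmap0 F : augmap F 0 = 0.
Proof. by rewrite /augmap big1 // => k _; rewrite mxE scale0r. Qed.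

Lemma augmap_mul F p (u : 'rV_p) (A : 'M_(p, rk F 0)) :
  augmap F (u *m A) = \sum_k u 0 k *: augmap F (row k A).
Proof.
rewrite /augmap; under [RHS]eq_bigr do rewrite scaler_sumr.
rewrite exchange_big; apply: eq_bigr => l _; rewrite mxE scaler_suml.
by apply: eq_bigr => k _; rewrite scalerA mxE.
Qed.

(** The condition for lifting along the differential; in homological degree zero
    it refers to the augmentation. *)
Definition mxcycle F p i : 'M[P]_(p, rk F i) -> Prop :=
  match i with
  | 0%N => fun A => forall k, augmap F (row k A) = 0
  | i'.+1 => fun A => A *m dif F i' = 0
  end.

Lemma gpartN d (x : N) : gpart d x -> gpart d (- x).
Proof.
move=> hx; rewrite -scaleN1r -[d]add0n; apply: gpartM => //.
by rewrite rpredN dhomog1.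
Qed.

Lemma gpart_suml d (I : Type) (s : seq I) (Q : pred I) (f : I -> N) :
  (forall i, Q i -> gpart d (f i)) -> gpart d (\sum_(i <- s | Q i) f i).
Proof.
move=> hf; apply: (big_ind (gpart d)) => //; first exact: gpart0.
exact: gpartD.
Qed.

Section Resolution.
Variable G : free_seq N.
Hypothesis rG : graded_free_resolution G.

Lemma res_hmx i : hmx (sh G i.+1) (sh G i) (dif G i).
Proof.
by case: rG => h _ _ _ _ k l; have := h i k l; case: ifP => // _ /eqP.
Qed.

Lemma mxcycle_dif p i (B : 'M_(p, rk G i.+1)) : mxcycle (B *m dif G i).
Proof.
case: rG => _ _ _ ex0 exS; case: i B => [|i] B /=.
  by move=> k; rewrite row_mul; apply/ex0; exists (row k B).
apply/row_matrixP => k; rewrite !row_mul row0.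
by apply/(exS i); exists (row k B).
Qed.

Lemma mxcycle_lift p i (a : 'I_p -> nat) (A : 'M_(p, rk G i)) :
  hmx a (sh G i) A -> mxcycle A ->
  exists B, hmx a (sh G i.+1) B /\ B *m dif G i = A.
Proof.
move=> hA cA; apply: hmx_lift hA _ => [|k]; first exact: res_hmx.
case: rG => _ _ _ ex0 exS; case: i A cA => [|i] A /= cA.
  by apply/ex0/cA.
by apply/(exS i); rewrite -row_mul cA row0.
Qed.

(** The components of any lift map to the components of [x], and these vanish
    outside degree [d] because the sum of the graded parts of [N] is direct. *)
Lemma aug_lift d (x : N) : gpart d x ->
  exists w, hmx (fun _ : 'I_1 => d) (sh G 0) w /\ augmap G w = x.
Proof.
case: rG => _ ha hs _ _ hx; have [v vx] := hs x.
pose w e := hproj (fun _ : 'I_1 => e) (sh G 0) v.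
exists (w d); split; first exact: hproj_hmx.
have hw e : gpart e (augmap G (w e)).
  rewrite /augmap; apply: gpart_suml => k _; rewrite mxE.
  case: leqP => [le|_]; last by rewrite scale0r; apply: gpart0.
  by rewrite -{1}(subnK le); apply: gpartM => //; apply: pihomogP.
(* All components of degree at least [m] vanish, and [d < m]. *)
pose m := (d.+1 + \max_k (sh G 0 k + msize (v 0%R k)))%N.
have vE : \sum_(e < m) w e = v.
  apply/rowP => k; rewrite summxE.
  pose s := sh G 0 k; pose m' := (m - s)%N.
  have bk : (s + msize (v 0%R k) <= m)%N.
    apply: leq_trans (leq_addl _ _).
    exact: (leq_bigmax (F := fun k => (sh G 0 k + msize (v 0%R k))%N)).
  have sm : (s <= m)%N by apply: leq_trans bk; apply: leq_addr.
  rewrite [RHS](@pihomog_partitionE _ _ mdeg m') /=; last by rewrite leq_subRL.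
  rewrite -(big_mkord predT (fun e => w e 0%R k)) (big_cat_nat (leq0n s) sm) //=.
  rewrite big_nat big1 ?add0r => [|e /andP[_ es]]; last by rewrite mxE leqNgt es.
  rewrite -{1}[s]add0n big_addn big_mkord; apply: eq_bigr => e _.
  by rewrite mxE leq_addl addnK.
pose c e := augmap G (w e) - (if e == d then x else 0).
have hc e : gpart e (c e).
  apply: gpartD => //; apply: gpartN; case: eqP => [->//|_]; exact: gpart0.
have dm : (d < m)%N by rewrite /m addSn ltnS leq_addr.
have c0 : \sum_(e < m) c e = 0.
  rewrite sumrB -big_mkcond (big_pred1 (Ordinal dm)) //= -[X in _ - X]vx -vE.
  by rewrite (big_morph _ (fun u v => _ : augmap G (u + v) = augmap G u + augmap G v)
       (augmap0 G)) ?subrr // => u u'; rewrite -[u]scale1r augmap_linear !scale1r.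
by have /eqP := gpart_direct hc c0 dm; rewrite /c eqxx subr_eq0 => /eqP.
Qed.

End Resolution.

(** The identity of [N] lifts, one homological degree at a time. The invariant
    kept along the recursion is that the differential followed by the last map
    has cycles as rows, which is what makes the next lift possible. *)
Lemma chain_map_exists F G :
  graded_free_resolution F -> graded_free_resolution G ->
  exists f : forall i, 'M[P]_(rk F i, rk G i),
    [/\ forall i, hmx (sh F i) (sh G i) (f i),
        forall k, augmap G (row k (f 0%N)) = aug F k
      & forall i, f i.+1 *m dif G i = dif F i *m f i].
Proof.
move=> rF rG.
pose good i (A : 'M[P]_(rk F i, rk G i)) :=
  [/\ hmx (sh F i) (sh G i) A, mxcycle (dif F i *m A) &
    match i return 'M[P]_(rk F i, rk G i) -> Prop with
    | 0%N => fun A => forall k, augmap G (row k A) = aug F k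
    | _ => fun=> True end A].
have [||f hf] := @dependent_choice (fun i => 'M[P]_(rk F i, rk G i)) good
  (fun i A B => B *m dif G i = dif F i *m A).
- have ha k : exists w : 'rV_(rk G 0),
     hmx (fun=> sh F 0 k) (sh G 0) w /\ augmap G w = aug F k.
    by apply: aug_lift => //; case: rF.
  have [w hw] := fin_all_exists ha.
  have hA k : augmap G (row k (\matrix_k w k)) = aug F k.
    by rewrite rowK; case: (hw k).
  exists (\matrix_k w k); split=> //.
    by move=> k l; rewrite mxE; case: (hw k) => /(_ 0 l).
  move=> k /=; rewrite row_mul augmap_mul; under eq_bigr do rewrite hA.
  by have /(_ k) := @mxcycle_dif F rF _ 0 1%:M; rewrite mul1mx.
- move=> i A [hA cA _].
  have [B [hB eB]] := mxcycle_lift rG (hmx_mul (@res_hmx F rF i) hA) cA.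
  exists B; split=> //; split=> //=; rewrite -mulmxA eB mulmxA.
  have := @mxcycle_dif F rF _ i.+1 1%:M; rewrite /= mul1mx => ->.
  by rewrite mul0mx.
exists f; split=> [i|k|i].
- by case: (hf i) => -[].
- by case: (hf 0%N) => -[].
- by case: (hf i).
Qed.

(** An endomorphism of a resolution over the zero map of [N] is null-homotopic.
    The invariant is that the differential kills the failure of the homotopy
    relation in the current degree. *)
Lemma homotopy_exists G (f : forall i, 'M[P]_(rk G i)) :
  graded_free_resolution G ->
  (forall i, hmx (sh G i) (sh G i) (f i)) ->
  (forall k, augmap G (row k (f 0%N)) = 0) ->
  (forall i, f i.+1 *m dif G i = dif G i *m f i) ->
  exists s : forall i, 'M[P]_(rk G i, rk G i.+1),
    [/\ forall i, hmx (sh G i) (sh G i.+1) (s i),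
        f 0%N = s 0%N *m dif G 0
      & forall i, f i.+1 = dif G i *m s i + s i.+1 *m dif G i.+1].
Proof.
move=> rG hf f0 fS.
have ddG i : dif G i.+1 *m dif G i = 0.
  by have := @mxcycle_dif G rG _ i.+1 1%:M; rewrite /= mul1mx.
pose good i (A : 'M[P]_(rk G i, rk G i.+1)) :=
  [/\ hmx (sh G i) (sh G i.+1) A,
    dif G i *m (f i - A *m dif G i) = 0 &
    match i return 'M[P]_(rk G i, rk G i.+1) -> Prop with
    | 0%N => fun A => f 0%N = A *m dif G 0
    | _ => fun=> True end A].
have [||s hs] := @dependent_choice (fun i => 'M[P]_(rk G i, rk G i.+1)) good
  (fun i A B => f i.+1 = dif G i *m A + B *m dif G i.+1).
- have [B [hB eB]] := mxcycle_lift rG (hf 0%N) f0.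
  by exists B; split; rewrite ?eB ?subrr ?mulmx0.
- move=> i A [hA cA _].
  have cB : (f i.+1 - dif G i *m A) *m dif G i = 0.
    by rewrite mulmxBl fS -mulmxA -mulmxBr cA.
  have [|B [hB eB]] := @mxcycle_lift G rG _ i.+1 (sh G i.+1) _ _ cB.
    by apply: hmxB => //; apply: hmx_mul hA; apply: res_hmx.
  exists B; split; last by rewrite eB addrC subrK.
  split=> //; rewrite eB opprB addrC subrK mulmxA ddG mul0mx //.
exists s; split=> [i||i].
- by case: (hs i) => -[].
- by case: (hs 0%N) => -[].
- by case: (hs i).
Qed.

Section Tensor.
Variable M : gmodule K n.

(** The map induced after tensoring with [M]. *)
Definition tmap p q (A : 'M[P]_(p, q)) (v : {ffun 'I_p -> M}) : {ffun 'I_q -> M} :=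
  [ffun l => \sum_k A k l *: v k].

Lemma tmap_linear p q (A : 'M[P]_(p, q)) : linear (tmap A).
Proof.
move=> a u v; apply/ffunP => l; rewrite !ffunE scaler_sumr -big_split.
by apply: eq_bigr => k _; rewrite !ffunE scalerDr !scalerA mulrC.
Qed.

Lemma tmap_mul p q s (A : 'M[P]_(p, q)) (B : 'M[P]_(q, s)) v :
  tmap (A *m B) v = tmap B (tmap A v).
Proof.
apply/ffunP => l; rewrite !ffunE.
under [RHS]eq_bigr do rewrite ffunE scaler_sumr.
rewrite exchange_big; apply: eq_bigr => k _; rewrite mxE scaler_suml.
by apply: eq_bigr => j _; rewrite scalerA mulrC.
Qed.

Lemma tmapD p q (A B : 'M[P]_(p, q)) v : tmap (A + B) v = tmap A v + tmap B v.
Proof.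
apply/ffunP => l; rewrite !ffunE -big_split; apply: eq_bigr => k _.
by rewrite mxE scalerDl.
Qed.

Lemma tmap1 p v : tmap (1%:M : 'M[P]_p) v = v.
Proof.
apply/ffunP => l; rewrite !ffunE (bigD1 l) //= mxE eqxx scale1r big1 ?addr0 // => k kl.
by rewrite mxE (negPf kl) scale0r.
Qed.

Lemma tmapr0 p q (A : 'M[P]_(p, q)) : tmap A 0 = 0.
Proof. by apply/ffunP => l; rewrite !ffunE big1 // => k _; rewrite ffunE scaler0. Qed.

Lemma tens_difE F i v : @tens_dif _ _ M N F i v = tmap (dif F i) v.
Proof. by []. Qed.

Lemma tens_part_tmap F G i i' j A v :
  hmx (sh F i) (sh G i') A ->
  @tens_part _ _ M N F i j v -> @tens_part _ _ M N G i' j (tmap A v).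
Proof.
move=> hA hv l; rewrite ffunE; case: leqP => lj.
  apply: (big_ind (gpart _)); [exact: gpart0|exact: gpartD|] => k _.
  have := hA k l; have := hv k; case: leqP => [kj vk|_ ->]; last first.
    by rewrite scaler0 => _; apply: gpart0.
  case: leqP => [lk Akl|_ ->]; last by rewrite scale0r; apply: gpart0.
  have -> : (j - sh G i' l = (sh F i k - sh G i' l) + (j - sh F i k))%N.
    by rewrite addnC addnBA // subnK.
  exact: gpartM.
rewrite big1 // => k _; have := hA k l; have := hv k.
case: leqP => [kj vk|_ ->]; last by rewrite scaler0.
by rewrite leqNgt (leq_ltn_trans kj lj) => ->; rewrite scale0r.
Qed.

Lemma tens_part_subspace F i j :
  subspace (@tens_part _ _ M N F i j : kres _ -> Prop).
Proof.
split=> [k|a u v hu hv k]; first by rewrite ffunE; case: ifP => // _; apply: gpart0.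
have := hu k; have := hv k; rewrite !ffunE.
case: ifP => [_ h1 h2|_ -> ->]; last by rewrite scaler0 addr0.
apply: gpartD => //; rewrite -[X in gpart X]add0n; apply: gpartM => //.
by rewrite -[a%:MP]mulr1 mul_mpolyC dhomogZ ?dhomog1.
Qed.

Lemma tens_cycle_subspace F i j :
  subspace (@tens_cycle _ _ M N F i j : kres _ -> Prop).
Proof.
have sP := tens_part_subspace F i j; case: i sP => [|i] sP; rewrite /tens_cycle.
  by split=> [|a u v [hu _] [hv _]]; split=> //; case: sP => // _; apply.
exact: (@kernel_subspace _ (kres _) (kres _) (tmap (dif F i)) _
  (kres_linear (tmap_linear _)) sP).
Qed.

Lemma tens_boundary_subspace F i j :
  subspace (@tens_boundary _ _ M N F i j : kres _ -> Prop).
Proof.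
exact: (@image_subspace _ (kres _) (kres _) (tmap (dif F i)) _
  (kres_linear (tmap_linear _)) (tens_part_subspace F i.+1 j)).
Qed.

Lemma chain_map_cycle F G (f : forall i, 'M[P]_(rk F i, rk G i)) i j v :
  (forall i, hmx (sh F i) (sh G i) (f i)) ->
  (forall i, f i.+1 *m dif G i = dif F i *m f i) ->
  @tens_cycle _ _ M N F i j v -> @tens_cycle _ _ M N G i j (tmap (f i) v).
Proof.
move=> hf fS [pv cv]; split; first exact: tens_part_tmap.
case: i v pv cv => [|i] v pv //= cv; rewrite tens_difE -tmap_mul fS tmap_mul.
by rewrite -tens_difE cv tmapr0.
Qed.

Lemma chain_map_boundary F G (f : forall i, 'M[P]_(rk F i, rk G i)) i j v :
  (forall i, hmx (sh F i) (sh G i) (f i)) ->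
  (forall i, f i.+1 *m dif G i = dif F i *m f i) ->
  @tens_boundary _ _ M N F i j v -> @tens_boundary _ _ M N G i j (tmap (f i) v).
Proof.
move=> hf fS [w hw <-]; exists (tmap (f i.+1) w); first exact: tens_part_tmap.
by rewrite !tens_difE -!tmap_mul fS.
Qed.

(** The difference of [f] and the identity is null-homotopic, hence maps cycles
    to boundaries. *)
Lemma homotopic_id G (f : forall i, 'M[P]_(rk G i)) i j v :
  graded_free_resolution G ->
  (forall i, hmx (sh G i) (sh G i) (f i)) ->
  (forall k, augmap G (row k (f 0%N)) = aug G k) ->
  (forall i, f i.+1 *m dif G i = dif G i *m f i) ->
  @tens_cycle _ _ M N G i j v -> @tens_boundary _ _ M N G i j (tmap (f i) v - v).
Proof.
move=> rG hf f0 fS [pv cv].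
have [||| s [hs s0 sS]] := @homotopy_exists G (fun i => f i - 1%:M) rG.
- by move=> l; apply: hmxB => //; apply: hmx1.
- move=> k; rewrite addrC -scaleN1r linearP /= augmap_linear f0.
  rewrite /augmap (bigD1 k) //= !mxE eqxx scale1r big1 ?addr0 ?scaleN1r ?addNr //.
  by move=> l lk; rewrite !mxE eq_sym (negPf lk) scale0r.
- by move=> l; rewrite mulmxBl mulmxBr fS mulmx1 mul1mx.
have -> : tmap (f i) v - v = tmap (f i - 1%:M) v.
  by apply/eqP; rewrite subr_eq -{3}[v]tmap1 -tmapD subrK.
case: i v pv cv => [|i] v pv cv.
  by exists (tmap (s 0%N) v); rewrite ?tens_difE -?tmap_mul -?s0 //;
    apply: tens_part_tmap pv.
exists (tmap (s i.+1) v); first exact: tens_part_tmap pv.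
rewrite tens_difE sS tmapD !tmap_mul -[tmap (dif G i) v]tens_difE.
by rewrite [tens_dif v]cv tmapr0 add0r.
Qed.

(** Lift the identity of [N] in both directions: the composites lift the
    identity as well, so they are homotopic to the identity. *)
Lemma tor_independent F G i j m :
  graded_free_resolution F -> graded_free_resolution G ->
  has_dim_quot (@tens_cycle _ _ M N F i j) (@tens_boundary _ _ M N F i j) m ->
  has_dim_quot (@tens_cycle _ _ M N G i j) (@tens_boundary _ _ M N G i j) m.
Proof.
move=> rF rG.
have [f [hf f0 fS]] := chain_map_exists rF rG.
have [g [hg g0 gS]] := chain_map_exists rG rF.
have augE (A B : free_seq N) (h : forall i, 'M[P]_(rk A i, rk B i)) u :
    (forall k, augmap B (row k (h 0%N)) = aug A k) ->
    augmap B (u *m h 0%N) = augmap A u.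
  by move=> h0; rewrite augmap_mul; apply: eq_bigr => k _; rewrite h0.
apply: (@qdim_transfer _ (kres _) (kres _) _ _ _ _ (tmap (f i)) (tmap (g i))).
- exact/kres_linear/tmap_linear.
- exact/kres_linear/tmap_linear.
- exact: tens_cycle_subspace.
- exact: tens_boundary_subspace.
- exact: tens_boundary_subspace.
- by move=> v; apply: chain_map_cycle.
- by move=> v; apply: chain_map_boundary.
- by move=> v; apply: chain_map_cycle.
- by move=> v; apply: chain_map_boundary.
- move=> v cv; rewrite -tmap_mul.
  apply: (homotopic_id (f := fun i => f i *m g i)) => // [l|k|l].
  + exact: hmx_mul (hf l) (hg l).
  + by rewrite row_mul augE // f0.
  + by rewrite -mulmxA gS mulmxA fS mulmxA.
- move=> v cv; rewrite -tmap_mul.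
  apply: (homotopic_id (f := fun i => g i *m f i)) => // [l|k|l].
  + exact: hmx_mul (hg l) (hf l).
  + by rewrite row_mul augE // g0.
  + by rewrite -mulmxA fS mulmxA gS mulmxA.
Qed.

End Tensor.
End Comparison.

(** * The Koszul complex *)

Section Sign.
Variables (K : fieldType) (n : nat).
Implicit Types (S : {set 'I_n}) (i j k : 'I_n).

(** The sign of moving the basis vector [j] to its place in the wedge of [S]. *)
Definition ksgn j S : K := \prod_(i in S) (if (i < j)%N then -1 else 1).

Lemma ksgnU j k S : k \notin S ->
  ksgn j (k |: S) = (if (k < j)%N then -1 else 1) * ksgn j S.
Proof. by move=> kS; rewrite /ksgn big_setU1. Qed.

Lemma ksgn_min j S : (forall i, i \in S -> (j <= i)%N) -> ksgn j S = 1.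
Proof. by move=> h; rewrite /ksgn big1 // => i /h; rewrite ltnNge => ->. Qed.

Lemma ksgn_swap j k S : j \notin S -> k \notin S -> (j < k)%N ->
  ksgn j S * ksgn k (j |: S) = - (ksgn k S * ksgn j (k |: S)).
Proof.
move=> jS kS jk; rewrite !ksgnU // jk ltnNge (ltnW jk) /= mul1r mulN1r mulrN.
by rewrite mulrC.
Qed.

End Sign.

Section KoszulComplex.
Variables (K : fieldType) (n : nat).
Local Notation P := {mpoly K[n]}.
Implicit Types (S : {set 'I_n}) (i j : 'I_n).

Section Module.
Variable V : lmodType P.
Local Notation chain := {ffun {set 'I_n} -> kres V}.

Definition kop j (v : kres V) : kres V := 'X_j *: (v : V).

Lemma kop_linear j : linear (kop j).
Proof. by move=> a u v; rewrite /kop scalerDr !kres_scaleE !scalerA mulrC. Qed.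

Lemma kopZ j a v : kop j (a *: v) = a *: kop j v.
Proof. by rewrite -[a *: v]addr0 kop_linear /kop scaler0 addr0. Qed.

(** The Koszul differential read on coefficients: the wedge of [j |: S] contributes
    to [S] when [j] is contracted. *)
Definition kdif (c : chain) : chain :=
  [ffun S : {set 'I_n} => \sum_(j | j \notin S) ksgn K j S *: kop j (c (j |: S))].

Lemma kdif_linear : linear kdif.
Proof.
move=> a c d; apply/ffunP => S; rewrite !ffunE scaler_sumr -big_split.
apply: eq_bigr => j _; rewrite !ffunE kop_linear scalerDr !scalerA.
by rewrite [_ * a]mulrC.
Qed.

(** The term of the ordered pair [(j, k)] is opposite to the one of [(k, j)]; the
    sum is split according to the order of [j] and [k] so that the cancellation
    holds in any characteristic. *)
Lemma kdif_kdif c : kdif (kdif c) = 0.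
Proof.
apply/ffunP => S; rewrite !ffunE.
pose F (j k : 'I_n) : kres V :=
  (ksgn K j S * ksgn K k (j |: S)) *: kop j (kop k (c (k |: (j |: S)))).
have -> : \sum_(j | j \notin S) ksgn K j S *: kop j (kdif c (j |: S)) =
    \sum_(j | j \notin S) \sum_(k : 'I_n | (k \notin S) && (k != j)) F j k.
  apply: eq_bigr => j jS; rewrite ffunE.
  rewrite (big_morph (kop j) (id1 := 0) (op1 := +%R)); last first.
  - by rewrite /kop scaler0.
  - by move=> u v; rewrite /kop scalerDr.
  rewrite scaler_sumr; apply: eq_big => [k|k _]; first by rewrite !inE negb_or andbC.
  by rewrite kopZ scalerA.
have FC (j k : 'I_n) : j \notin S -> k \notin S -> (j < k)%N -> F j k = - F k j.
  move=> jS kS jk; rewrite /F ksgn_swap // scaleNr.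
  by congr (- (_ *: _)); rewrite setUCA /kop !scalerA mulrC.
have E j : j \notin S -> \sum_(k : 'I_n | (k \notin S) && (k != j)) F j k =
    \sum_(k : 'I_n | (k \notin S) && (j < k)%N) F j k +
    \sum_(k : 'I_n | (k \notin S) && (k < j)%N) F j k.
  move=> jS; rewrite (bigID (fun k : 'I_n => (j < k)%N)) /=; congr (_ + _);
    apply: eq_bigl => k.
    by rewrite -andbA; congr (_ && _); rewrite -val_eqE /= neq_ltn; case: ltngtP.
  by rewrite -andbA; congr (_ && _); rewrite -leqNgt [RHS]ltn_neqAle.
rewrite (eq_bigr _ E) big_split /=.
rewrite [X in _ + X](exchange_big_dep (fun k : 'I_n => k \notin S)) /=;
  last by move=> j k _ /andP[].
rewrite -big_split /= big1 // => j jS.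
rewrite [X in _ + X](eq_bigl (fun k : 'I_n => (k \notin S) && (j < k)%N)); last first.
  by move=> k; rewrite jS.
rewrite -big_split big1 //= => k /andP[kS jk].
by rewrite FC // addNr.
Qed.

End Module.

(** The generators of the Koszul complex in homological degree [u] are the
    [u]-element sets of variables, listed by [kset]. *)
Definition kset u (k : 'I_#|[set S : {set 'I_n} | #|S| == u]|) : {set 'I_n} :=
  enum_val k.

Definition krk u : nat := #|[set S : {set 'I_n} | #|S| == u]|.

Lemma card_kset u (k : 'I_(krk u)) : #|kset k| = u.
Proof. by apply/eqP; have := enum_valP k; rewrite inE. Qed.

Lemma kset_inj u : injective (@kset u).
Proof. exact: enum_val_inj. Qed.

Lemma ksetP u S : #|S| = u -> exists k : 'I_(krk u), kset k = S.
Proof.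
move=> Su; have SK : S \in [set S : {set 'I_n} | #|S| == u] by rewrite inE Su.
by exists (enum_rank_in SK S); rewrite /kset enum_rankK_in.
Qed.

Section ToChain.
Variables (V : lmodType P) (u : nat).
Implicit Types (v : 'I_(krk u) -> kres V) (c : {ffun {set 'I_n} -> kres V}).

(** Families indexed by the generators of homological degree [u], as chains
    supported on the [u]-element sets. *)
Definition to_chain v : {ffun {set 'I_n} -> kres V} :=
  [ffun S : {set 'I_n} => \sum_(k | kset k == S) v k].

Lemma to_chain_kset v k : to_chain v (kset k) = v k.
Proof.
by rewrite ffunE (big_pred1 k) // => l; apply/eqP/eqP => [/kset_inj|->].
Qed.

Lemma to_chain_out v S : #|S| <> u -> to_chain v S = 0.
Proof.
by move=> Su; rewrite ffunE big1 // => k /eqP kS; case: Su; rewrite -kS card_kset.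
Qed.

Lemma to_chain_of c : (forall S, #|S| <> u -> c S = 0) ->
  to_chain (fun k => c (kset k)) = c.
Proof.
move=> hc; apply/ffunP => S; case: (eqVneq #|S| u) => [/ksetP[k <-]|/eqP Su].
  exact: to_chain_kset.
by rewrite to_chain_out // hc.
Qed.

End ToChain.

Definition kcoef S S' : P :=
  \sum_(j | (j \notin S') && (S == j |: S')) ksgn K j S' *: 'X_j.

Definition kmx u : 'M[P]_(krk u.+1, krk u) := \matrix_(k, l) kcoef (kset k) (kset l).

(** The matrices [kmx] represent the differential, in any module. *)
Lemma kdif_to_chain (V : lmodType P) u (v : 'I_(krk u.+1) -> kres V) :
  to_chain (fun l => \sum_k kmx u k l *: (v k : V) : V) = kdif (to_chain v).
Proof.
apply/ffunP => S; case: (eqVneq #|S| u) => [/ksetP[l <-]|/eqP Su]; last first.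
  rewrite to_chain_out // ffunE big1 // => j jS.
  rewrite to_chain_out ?/kop ?scaler0 //.
  by rewrite cardsU1 jS add1n => -[].
rewrite to_chain_kset [RHS]ffunE.
transitivity (\sum_k \sum_(j | (j \notin kset l) && (kset k == j |: kset l))
    (ksgn K j (kset l) *: 'X_j) *: (v k : V)).
  by apply: eq_bigr => k _; rewrite mxE scaler_suml.
rewrite (exchange_big_dep (fun j => j \notin kset l)) /=; last by move=> k j _ /andP[].
apply: eq_bigr => j jS; rewrite /kop ffunE scaler_sumr.
rewrite kres_scaleE scaler_sumr; apply: eq_big => k; first by rewrite jS.
by move=> _; rewrite scalerA mul_mpolyC.
Qed.

(** ** Acyclicity *)

Local Notation pchain := {ffun {set 'I_n} -> kres P^o}.

Lemma mcoeff_kop j (p : kres P^o) (m : 'X_{1..n}) :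
  (kop j p : P)@_m = if (0 < m j)%N then (p : P)@_(m - U_(j)) else 0.
Proof.
rewrite /kop /= /GRing.scale /= mulrC; case: ifP => mj.
  have {1}-> : m = (U_(j) + (m - U_(j)))%MM.
    by apply/mnmP => i; rewrite mnmDE mnmBE mnm1E; case: eqVneq => [<-|];
      rewrite ?subnKC ?subn0.
  by rewrite mcoeffMX.
apply: memN_msupp_eq0; rewrite (perm_mem (msuppMX _ _)); apply/negP => /mapP[m' _ mE].
by move: mj; rewrite mE mnmDE mnm1E eqxx.
Qed.

Lemma mcoeff_kdif (c : pchain) S (m : 'X_{1..n}) :
  (kdif c S : P)@_m = \sum_(j | j \notin S)
    ksgn K j S * (if (0 < m j)%N then (c (j |: S) : P)@_(m - U_(j)) else 0).
Proof.
rewrite ffunE (raddf_sum (mcoeff m)); apply: eq_bigr => j _.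
by rewrite kres_scaleE /= mcoeffCM mcoeff_kop.
Qed.

Definition vanish_below j (m : 'X_{1..n}) : bool :=
  [forall i : 'I_n, (i < j)%N ==> (m i == 0%N)].

Lemma vanish_belowP j (m : 'X_{1..n}) :
  reflect (forall i, (i < j)%N -> m i = 0%N) (vanish_below j m).
Proof.
apply: (iffP forallP) => h i; first by move=> ij; apply/eqP; have := h i; rewrite ij.
by apply/implyP => /h ->.
Qed.

(** Division by the variable [j] of the part made of the monomials whose least
    variable is [j]. *)
Definition kquo j (p : P) : P :=
  \sum_(m <- msupp p | (0 < m j)%N && vanish_below j m) p@_m *: 'X_[m - U_(j)].

Lemma vanish_belowD j m : vanish_below j (m + U_(j)) = vanish_below j m.
Proof.
apply: eq_forallb => i; case: ltnP => //= ij; rewrite mnmDE mnm1E.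
by rewrite -val_eqE /= (gtn_eqF ij) addn0.
Qed.

Lemma mcoeff_kquo j p m :
  (kquo j p)@_m = if vanish_below j m then p@_(m + U_(j)) else 0.
Proof.
rewrite raddf_sum /=.
under eq_bigr do rewrite mcoeffZ mcoeffX.
have E (m' : 'X_{1..n}) : ((0 < m' j)%N && (m' - U_(j) == m)%MM) = (m' == m + U_(j))%MM.
  apply/andP/eqP => [[m0 /eqP <-]|->].
    by apply/mnmP => i; rewrite mnmDE mnmBE mnm1E; case: eqVneq => [<-|];
      rewrite ?subnK ?subn0 ?addn0.
  split; first by rewrite mnmDE mnm1E eqxx addn1.
  by apply/eqP/mnmP => i; rewrite mnmBE mnmDE addnK.
rewrite -vanish_belowD.
transitivity (\sum_(m' <- msupp p | m' == (m + U_(j))%MM)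
    (if vanish_below j m' then p@_m' else 0)).
  rewrite big_mkcond [RHS]big_mkcond; apply: eq_bigr => m' _.
  rewrite -E; case: (0 < m' j)%N => //=; case: vanish_below; last by rewrite if_same.
  by case: eqP => _; rewrite ?mulr1 ?mulr0.
case: (boolP ((m + U_(j))%MM \in msupp p)) => [hm|hm].
  rewrite -big_filter filter_pred1_uniq ?msupp_uniq // big_seq1 //.
rewrite (memN_msupp_eq0 hm) if_same big_seq_cond big1 // => m' /andP[hm' /eqP e].
by rewrite -e hm' in hm.
Qed.

Definition is_min S j : bool := (j \in S) && [forall i in S, (j <= i)%N].

Lemma is_minP S j : reflect (j \in S /\ forall i, i \in S -> (j <= i)%N) (is_min S j).
Proof.
by apply: (iffP andP) => -[jS h]; split=> //; [apply/forall_inP|apply/forall_inP].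
Qed.

Lemma is_min_uniq S j k : is_min S j -> is_min S k -> j = k.
Proof.
move=> /is_minP[jS hj] /is_minP[kS hk]; apply/val_inj/eqP.
by rewrite /= eqn_leq hj // hk.
Qed.

(** The monomial [m] times the wedge of [S] is divided by the least variable
    occurring in either of them, and that variable is wedged in front; the
    result is zero when the variable already occurs in [S]. This is the tensor
    product of the contractions of the complexes of the single variables. *)
Definition khom (c : pchain) : pchain :=
  [ffun S : {set 'I_n} =>
    (if [pick j | is_min S j] is Some j then kquo j (c (S :\ j)) else 0 : P) : kres P^o].

Lemma mcoeff_khom (c : pchain) S j m : is_min S j ->
  (khom c S : P)@_m = if vanish_below j m then (c (S :\ j) : P)@_(m + U_(j)) else 0.
Proof.
move=> Sj; rewrite ffunE; case: pickP => [k Sk|/(_ j)]; last by rewrite Sj.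
by rewrite (is_min_uniq Sk Sj) mcoeff_kquo.
Qed.

Lemma khom_set0 (c : pchain) : khom c set0 = 0.
Proof. by rewrite ffunE; case: pickP => // j /is_minP[]; rewrite inE. Qed.

Lemma ex_min S i : i \in S -> exists j, is_min S j.
Proof.
move=> iS; case: (arg_minnP (fun i : 'I_n => i : nat) iS) => j jS hj.
by exists j; apply/is_minP.
Qed.

(** Compare coefficients at the monomial [m] and the set [S], according to the
    least variable [j] occurring in either. If [j] is in [S], the first
    summand cancels the second one except for the term reintroducing [j]. If not,
    the second summand vanishes and only the variable [j] contributes to the
    first. *)
Lemma khom_homotopy (c : pchain) : (c set0 : P)@_0%MM = 0 ->
  kdif (khom c) + khom (kdif c) = c.
Proof.
move=> c0; apply/ffunP => S; apply/mpolyP => m; rewrite ffunE.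
rewrite (raddfD (mcoeff m)) /= mcoeff_kdif.
pose A := S :|: [set i | (0 < m i)%N].
have supp i : (0 < m i)%N -> i \in A by move=> mi; rewrite !inE mi orbT.
case: (set_0Vmem A) => [A0|[i /ex_min[j /is_minP[jA minj]]]].
  have -> : S = set0.
    by apply/setP => i; have /setP/(_ i) := A0; rewrite !inE => /negbT/norP[/negPf].
  have -> : m = 0%MM.
    apply/mnmP => i; rewrite mnm0E; have /setP/(_ i) := A0; rewrite !inE.
    by move/negbT/norP => [_]; rewrite lt0n negbK => /eqP.
  by rewrite khom_set0 mcoeff0 addr0 c0 big1 // => j _; rewrite mnm0E mulr0.
have van : vanish_below j m.
  apply/vanish_belowP => i' i'j; apply/eqP; rewrite -leqn0 leqNgt.
  by apply/negP => /supp/minj; rewrite leqNgt i'j.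
have minS i' : i' \in S -> (j <= i')%N by move=> i'S; apply: minj; rewrite inE i'S.
case: (boolP (j \in S)) => jS.
  have Sj : is_min S j by apply/is_minP.
  rewrite (mcoeff_khom _ _ Sj) van mcoeff_kdif [X in _ + X](bigD1 j) /=;
    last by rewrite !inE eqxx.
  rewrite mnmDE mnm1E eqxx addn1 /= setD1K // addmK.
  rewrite ksgn_min ?mul1r; last by move=> i'; rewrite !inE => /andP[_]; apply: minS.
  rewrite addrCA -[RHS]addr0; congr (_ + _).
  rewrite [X in _ + X](eq_bigl (fun k : 'I_n => k \notin S)); last first.
    move=> k; rewrite !inE negb_and negbK; case: eqVneq => [->|] /=;
      first by rewrite jS.
    by rewrite andbT.
  rewrite -big_split big1 //= => k kS.
  have kj : k != j by apply: contraNneq kS => ->.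
  rewrite mnmDE mnm1E eq_sym (negPf kj) addn0; case: posnP => [_|mk];
    first by rewrite !mulr0 addr0.
  have jk : (j < k)%N by rewrite ltn_neqAle eq_sym kj; apply/minj/supp.
  have kSj : is_min (k |: S) j.
    by apply/is_minP; split=> [|i'];
      rewrite !inE ?jS ?orbT // => /orP[/eqP->|/minS//]; apply: ltnW.
  rewrite (mcoeff_khom _ _ kSj).
  have -> : vanish_below j (m - U_(k)).
    by apply/vanish_belowP => i' i'j; rewrite mnmBE (vanish_belowP _ _ van).
  have -> : ksgn K k S = - ksgn K k (S :\ j).
    by rewrite -{1}(setD1K jS) ksgnU ?jk ?mulN1r // !inE eqxx.
  have -> : (k |: S) :\ j = k |: S :\ j.
    by rewrite setDUl; congr (_ :|: _); apply/setP => i'; rewrite !inE;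
      case: (eqVneq i' k) => [->|_]; rewrite ?kj ?andbF.
  have -> : (m - U_(k) + U_(j) = m + U_(j) - U_(k))%MM.
    apply/mnmP => i'; rewrite !(mnmDE, mnmBE, mnm1E); case: eqVneq => [<-|] /=.
      by rewrite eq_sym (negPf kj) addn0 addn0.
    by rewrite !subn0.
  by rewrite mulNr addNr.
have mj : (0 < m j)%N by move: jA; rewrite !inE (negPf jS).
have minS' i' : i' \in S -> (j < i')%N.
  by move=> i'S; rewrite ltn_neqAle minS // andbT; apply: contraNneq jS => /val_inj ->.
have -> : (khom (kdif c) S : P)@_m = 0.
  case: (set_0Vmem S) => [->|[i' /ex_min[k Sk]]]; first by rewrite khom_set0 mcoeff0.
  rewrite (mcoeff_khom _ _ Sk); case: ifP => // /vanish_belowP/(_ j).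
  by case/is_minP: Sk => kS _; rewrite minS' // => /(_ isT) m0; rewrite m0 in mj.
rewrite addr0 (bigD1 j) //= mj big1 ?addr0; last first.
  move=> k /andP[kS kj]; case: posnP => [_|mk]; first by rewrite mulr0.
  have jk : (j < k)%N by rewrite ltn_neqAle eq_sym kj; apply/minj/supp.
  have [l Sl] : exists l, is_min (k |: S) l.
    by apply: (ex_min (i := k)); rewrite !inE eqxx.
  rewrite (mcoeff_khom _ _ Sl); case: ifP => [/vanish_belowP/(_ j)|_];
    last by rewrite mulr0.
  have -> : (j < l)%N by case/is_minP: Sl; rewrite !inE => /orP[/eqP->//|/minS'].
  move/(_ isT); rewrite mnmBE mnm1E (negPf kj) subn0 => m0.
  by rewrite m0 in mj.
rewrite ksgn_min // mul1r.
have jSj : is_min (j |: S) j.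
  by apply/is_minP; split=> [|i']; rewrite !inE ?eqxx // => /orP[/eqP->//|/minS].
rewrite (mcoeff_khom _ _ jSj).
have -> : vanish_below j (m - U_(j)).
  by apply/vanish_belowP => i' i'j; rewrite mnmBE (vanish_belowP _ _ van).
rewrite setU1K // submK //; apply/mnm_lepP => i'.
by rewrite mnm1E; case: eqVneq => [<-|].
Qed.

Lemma kdif_exact u (c : pchain) :
  (forall S, #|S| <> u -> c S = 0) -> (c set0 : P)@_0%MM = 0 -> kdif c = 0 ->
  exists2 b : pchain, forall S, #|S| <> u.+1 -> b S = 0 & kdif b = c.
Proof.
move=> hc c0 dc; exists (khom c) => [S Su|].
  rewrite ffunE; case: pickP => // j /is_minP[jS _]; rewrite hc.
    by rewrite /kquo (_ : msupp (0 : kres P^o) = msupp (0 : P)) // msupp0 big_nil.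
  by move=> cS; apply: Su; rewrite (cardsD1 j S) jS cS.
have := khom_homotopy c0; rewrite dc.
suff -> : khom 0 = 0 by rewrite addr0.
apply/ffunP => S; rewrite !ffunE; case: pickP => // j _.
by rewrite ffunE /kquo (_ : msupp (0 : kres P^o) = msupp (0 : P)) // msupp0 big_nil.
Qed.

Definition koszul : free_seq (resfield K n) :=
  @FreeSeq K n (resfield K n) krk (fun d _ => d) kmx (fun=> 1 : K).

Lemma kcoef_homog S S' : kcoef S S' \is 1.-homog.
Proof. by apply: rpred_sum => j _; apply: dhomogZ; rewrite dhomogX /= mdeg1. Qed.

Definition row_chain u (v : 'rV[P]_(krk u)) : pchain := to_chain (fun k => v 0 k : P^o).

Lemma row_chain_inj u : injective (@row_chain u).
Proof.
move=> v w /ffunP vw; apply/rowP => k.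
by have := vw (kset k); rewrite !to_chain_kset.
Qed.

Lemma row_chain_mul u (v : 'rV[P]_(krk u.+1)) :
  row_chain (v *m kmx u) = kdif (row_chain v).
Proof.
rewrite -kdif_to_chain; apply/ffunP => S; rewrite !ffunE; apply: eq_bigr => l _.
by rewrite mxE; apply: eq_bigr => k _; rewrite mulrC.
Qed.

Lemma row_chain_out u (v : 'rV[P]_(krk u)) S : #|S| <> u -> row_chain v S = 0.
Proof. exact: to_chain_out. Qed.

Lemma row_chain_of u (c : pchain) : (forall S, #|S| <> u -> c S = 0) ->
  row_chain (\row_k (c (kset k) : P) : 'rV_(krk u)) = c.
Proof.
move=> hc; rewrite -[RHS](to_chain_of hc); apply/ffunP => S; rewrite !ffunE.
by apply: eq_bigr => k _; rewrite mxE.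
Qed.

Lemma augmap_koszul (v : 'rV[P]_(krk 0)) :
  augmap koszul v = ((row_chain v set0 : P)@_0%MM : K).
Proof.
rewrite ffunE (raddf_sum (mcoeff 0%MM)); apply: esym.
apply: eq_big => [k|k _]; last by rewrite /GRing.scale /= /resmod_scale /= mulr1.
by apply/eqP/cards0_eq; rewrite card_kset.
Qed.

Lemma row_chain0 u : row_chain (0 : 'rV[P]_(krk u)) = 0.
Proof. by apply/ffunP => S; rewrite !ffunE big1 // => k _; rewrite mxE. Qed.

(** Exactness in every degree at once; in positive degree the first
    hypothesis holds since the chain vanishes on the empty set. *)
Lemma row_chain_exact u (v : 'rV[P]_(krk u)) :
  (row_chain v set0 : P)@_0%MM = 0 -> kdif (row_chain v) = 0 ->
  exists w, v = w *m kmx u.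
Proof.
move=> v0 dv; have [b hb db] := kdif_exact (@row_chain_out u v) v0 dv.
exists (\row_k (b (kset k) : P)); apply: row_chain_inj.
by rewrite row_chain_mul row_chain_of.
Qed.

Lemma koszul_resolution : graded_free_resolution koszul.
Proof.
split=> /=.
- by move=> i k l; rewrite leqnSn subSnn mxE kcoef_homog.
- by move=> k; left.
- move=> x; pose c : pchain :=
  [ffun S : {set 'I_n} => (if S == set0 then x%:MP else 0 : P) : kres P^o].
  exists (\row_k (c (kset k) : P)); rewrite augmap_koszul row_chain_of.
    by rewrite ffunE eqxx mcoeffC eqxx mulr1.
  by move=> S; rewrite ffunE; case: eqP => // -> []; rewrite cards0.
- move=> v; rewrite augmap_koszul; split=> [v0|[w ->]].
    apply: row_chain_exact => //; apply/ffunP => S; rewrite !ffunE.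
    rewrite big1 // => j jS; rewrite row_chain_out ?/kop ?scaler0 //.
    by rewrite cardsU1 jS.
  rewrite row_chain_mul mcoeff_kdif big1 // => j _.
  by rewrite mnm0E mulr0.
- move=> u v; split=> [dv|[w ->]].
    apply: row_chain_exact; last by rewrite -row_chain_mul dv row_chain0.
    by rewrite row_chain_out ?mcoeff0 // cards0.
  by apply: row_chain_inj; rewrite !row_chain_mul kdif_kdif row_chain0.
Qed.

End KoszulComplex.

(** * Tor from dimensions of spaces of Koszul cycles *)

Section TorKoszul.
Variables (K : fieldType) (n : nat) (M : gmodule K n).
Local Notation P := {mpoly K[n]}.
Local Notation chain := {ffun {set 'I_n} -> kres M}.
Implicit Types (S : {set 'I_n}) (c : chain) (u d e : nat).

(** Chains of homological degree [u] and internal degree [u + e]: a [u]-fold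
    wedge already has degree [u], so the coefficients have degree [e]. *)
Definition kpart u e c : Prop :=
  forall S, if #|S| == u then gpart e (c S : M) else c S = 0.

Definition kcycle u e c : Prop := kpart u e c /\ kdif c = 0.

(** For [e = 0] no coefficient is available one homological degree up. *)
Definition kboundary u e c : Prop :=
  if e is e'.+1 then image (@kdif K n M) (kpart u.+1 e') c else c = 0.

Lemma gpart_subspace e : subspace (gpart e : kres M -> Prop).
Proof.
split=> [|a x y hx hy]; first exact: gpart0.
apply: gpartD => //; rewrite -[X in gpart X]add0n; apply: gpartM => //.
by rewrite -[a%:MP]mulr1 mul_mpolyC dhomogZ ?dhomog1.
Qed.

Lemma kpart_subspace u e : subspace (kpart u e).
Proof.
have [G0 GD] := gpart_subspace e.
split=> [S|a c d hc hd S]; first by rewrite ffunE; case: ifP.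
have := hc S; have := hd S; rewrite !ffunE.
by case: ifP => [_ h1 h2|_ -> ->]; [apply: GD|rewrite scaler0 addr0].
Qed.

Lemma kcycle_subspace u e : subspace (kcycle u e).
Proof. exact: kernel_subspace (@kdif_linear K n M) (kpart_subspace u e). Qed.

Lemma kboundary_subspace u e : subspace (kboundary u e).
Proof.
case: e => [|e]; first exact: zerosp_subspace.
exact: image_subspace (@kdif_linear K n M) (kpart_subspace _ _).
Qed.

Lemma kdif_kpart u e c : kpart u.+1 e c -> kpart u e.+1 (kdif c).
Proof.
move=> hc S; rewrite ffunE; case: eqP => Su.
  apply: (subspace_sum (gpart_subspace e.+1)) => j jS.
  apply: (subspaceZ (gpart_subspace e.+1)); rewrite -add1n; apply: gpartM.
    by rewrite dhomogX /= mdeg1.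
  by have := hc (j |: S); rewrite cardsU1 jS Su eqxx.
rewrite big1 // => j jS; have := hc (j |: S).
by rewrite cardsU1 jS add1n eqSS; case: eqP => // _ ->; rewrite /kop !scaler0.
Qed.

Lemma kboundary_kcycle u e c : kboundary u e c -> kcycle u e c.
Proof.
case: e => [|e] /=; first by move->; case: (kcycle_subspace u 0).
by case=> b hb <-; split; [apply: kdif_kpart|apply: kdif_kdif].
Qed.

Lemma kcycle0 e c : kcycle 0 e c <-> kpart 0 e c.
Proof.
split=> [[]//|hc]; split=> //; apply/ffunP => S; rewrite !ffunE big1 // => j jS.
by have := hc (j |: S); rewrite cardsU1 jS /= => ->; rewrite /kop !scaler0.
Qed.

(** ** Comparison with the chosen resolution *)

Definition of_chain u (c : chain) : kres {ffun 'I_(krk n u) -> M} :=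
  [ffun k : 'I_(krk n u) => (c (kset k) : M)].

Definition tens_chain u (v : kres {ffun 'I_(krk n u) -> M}) : chain :=
  to_chain (fun k => (v : {ffun 'I_(krk n u) -> M}) k).

Lemma of_chain_linear u : linear (@of_chain u).
Proof. by move=> a c d; apply/ffunP => k; rewrite !ffunE. Qed.

Lemma tens_chain_linear u : linear (@tens_chain u).
Proof.
move=> a v w; apply/ffunP => S; rewrite !ffunE scaler_sumr -big_split.
by apply: eq_bigr => k _; rewrite !ffunE.
Qed.

Lemma tens_chainK u : cancel (@tens_chain u) (@of_chain u).
Proof. by move=> v; apply/ffunP => k; rewrite ffunE to_chain_kset. Qed.

Lemma of_chainK u e c : kpart u e c -> tens_chain (of_chain u c) = c.
Proof.
move=> hc; have hc' S : #|S| <> u -> c S = 0.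
  by move=> Su; have := hc S; case: eqP.
rewrite -[RHS](to_chain_of hc'); apply/ffunP => S; rewrite !ffunE.
by apply: eq_bigr => k _; rewrite ffunE.
Qed.

Local Notation kz := (koszul K n).

Lemma tens_chain_dif u (v : {ffun 'I_(krk n u.+1) -> M}) :
  @tens_chain u (@tens_dif K n M _ kz u v) = kdif (@tens_chain u.+1 v).
Proof.
rewrite /tens_chain -kdif_to_chain; apply/ffunP => S; rewrite !ffunE.
by apply: eq_bigr => k _; rewrite ffunE.
Qed.

Lemma tens_partE u e (v : {ffun 'I_(krk n u) -> M}) :
  @tens_part K n M _ kz u (u + e) v <-> kpart u e (@tens_chain u v).
Proof.
split=> h.
  move=> S; case: eqP => Su; last by rewrite /tens_chain to_chain_out.
  have [k <-] := ksetP Su; rewrite /tens_chain to_chain_kset.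
  by have := h k; rewrite /= leq_addr addKn.
move=> k; rewrite /= leq_addr addKn; have := h (kset k).
by rewrite card_kset eqxx /tens_chain to_chain_kset.
Qed.

Lemma tens_part_low u v (x : {ffun 'I_(krk n u) -> M}) : (v < u)%N ->
  @tens_part K n M _ kz u v x -> x = 0.
Proof.
by move=> vu h; apply/ffunP => k; have := h k; rewrite /= leqNgt vu ffunE.
Qed.

Lemma tens_dif0 u : @tens_dif K n M _ kz u 0 = 0.
Proof. exact: tmapr0. Qed.

Lemma tens_cycleE u e (v : {ffun 'I_(krk n u) -> M}) :
  @tens_cycle K n M _ kz u (u + e) v <-> kcycle u e (@tens_chain u v).
Proof.
rewrite /tens_cycle tens_partE; case: u v => [|u] v.
  by rewrite kcycle0; split=> [[]|].
rewrite /kcycle -tens_chain_dif.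
suff -> : @tens_dif K n M _ kz u v = 0 <->
  tens_chain (@tens_dif K n M _ kz u v) = 0 by [].
split=> [->|h]; first by apply/ffunP => S; rewrite !ffunE big1 // => k _; rewrite ffunE.
rewrite -[LHS](@tens_chainK u) h.
by apply/ffunP => k; rewrite !ffunE.
Qed.

Lemma tens_boundaryE u e (v : {ffun 'I_(krk n u) -> M}) :
  @tens_boundary K n M _ kz u (u + e) v <-> kboundary u e (@tens_chain u v).
Proof.
split.
  case: e => [|e] [w hw <-] /=.
    have -> : w = 0 by apply: tens_part_low hw; rewrite addn0.
    rewrite tens_dif0.
    by apply/ffunP => S; rewrite !ffunE big1 // => k _; rewrite ffunE.
  exists (@tens_chain u.+1 w); last by rewrite tens_chain_dif.
  by apply/tens_partE; rewrite addSnnS.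
case: e => [|e] /= => [v0|[c hc cv]].
  exists 0; first by case: (@tens_part_subspace K n _ M kz u.+1 (u + 0)).
  by rewrite tens_dif0 -[RHS](@tens_chainK u) v0; apply/ffunP => k; rewrite !ffunE.
exists (of_chain u.+1 c).
  by rewrite -addSnnS; apply/tens_partE; rewrite (of_chainK hc).
apply: (can_inj (@tens_chainK u)).
by rewrite tens_chain_dif (of_chainK hc).
Qed.

Lemma resolution_resfield : graded_free_resolution (resolution (resfield K n)).
Proof.
by apply: epsilon_spec; exists (koszul K n); apply: koszul_resolution.
Qed.

Lemma tor_dim_eq u v m :
  has_dim_quot (@tens_cycle K n M _ kz u v) (@tens_boundary K n M _ kz u v) m ->
  tor_dim M (resfield K n) u v = m.
Proof.
move=> h; apply: dim_quot_eq; first exact: tens_boundary_subspace.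
exact: tor_independent (koszul_resolution K n) resolution_resfield h.
Qed.

Lemma tor_dim_low u v : (v < u)%N -> tor_dim M (resfield K n) u v = 0%N.
Proof.
move=> vu; apply: tor_dim_eq; exists (fun=> 0); split=> [[]//|x|c _ []//].
case=> /(tens_part_low vu) -> _; exists (fun=> 0); rewrite big_ord0 subr0.
by case: (@tens_boundary_subspace K n _ M kz u v).
Qed.

Lemma tor_dim_qdim u e m :
  qdim (kcycle u e) (kboundary u e) m -> tor_dim M (resfield K n) u (u + e) = m.
Proof.
move=> h; apply: tor_dim_eq; apply/has_dim_quotE; move: h.
apply: (qdim_transfer (f := of_chain u) (g := @tens_chain u)).
- exact: of_chain_linear.
- exact: tens_chain_linear.
- exact: kcycle_subspace.
- exact: kboundary_subspace.
- exact: tens_boundary_subspace.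
- by move=> c hc; apply/tens_cycleE; rewrite (of_chainK hc.1).
- move=> c hc; apply/tens_boundaryE; have [pc _] := kboundary_kcycle hc.
  by rewrite (of_chainK pc).
- by move=> v /tens_cycleE.
- by move=> v /tens_boundaryE.
- by move=> c [pc _]; rewrite (of_chainK pc) subrr; case: (kboundary_subspace u e).
- by move=> v _; rewrite tens_chainK subrr;
  case: (@tens_boundary_subspace K n _ M kz u (u + e)).
Qed.

(** ** Counting *)

(** On the linear strand there are no boundaries. *)
Lemma tor_dim_linear u z : vdim (kcycle u 0) z -> tor_dim M (resfield K n) u u = z.
Proof.
move=> hz; rewrite -{2}[u]addn0; apply: tor_dim_qdim.
exact: qdim_ext hz.
Qed.

(** By rank-nullity for the differential out of homological degree [u.+1], the
    dimensions of cycles and chains determine those of Tor; the equation is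
    written so as to avoid subtractions. *)
Lemma tor_dim_count u e z b z' :
  vdim (kcycle u e.+1) z -> vdim (kpart u.+1 e) b -> vdim (kcycle u.+1 e) z' ->
  (tor_dim M (resfield K n) u (u + e.+1) + b = z + z')%N.
Proof.
move=> hz hb hz'.
have [le1 hB] := vdim_image (@kdif_linear K n M) (kpart_subspace _ _) hb hz'.
have [le2 hq] := qdim_sub_quo (kcycle_subspace u e.+1) (kboundary_subspace u e.+1)
  (@kboundary_kcycle u e.+1) hz hB.
by rewrite (tor_dim_qdim hq) -{2}(subnK le1) addnA subnK.
Qed.

(** There is one copy of the degree [e] part of [M] for each [u]-element set. *)
Lemma vdim_kpart u e h : vdim (gpart e : kres M -> Prop) h ->
  vdim (kpart u e) ('C(n, u) * h).
Proof.
move=> hh; have -> :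
  ('C(n, u) * h = \sum_(S : {set 'I_n}) if #|S| == u then h else 0)%N.
  transitivity (\sum_(S : {set 'I_n} | #|S| == u) h)%N; last by rewrite big_mkcond.
  have -> : 'C(n, u) = #|[set S : {set 'I_n} | #|S| == u]|.
    have := cards_draws [set: 'I_n] u; rewrite cardsT card_ord => <-.
    by apply: eq_card => S; rewrite !inE subsetT.
  by rewrite -sum_nat_const; apply: eq_bigl => S; rewrite inE.
apply: (@vdim_product _ _ _ _ (fun=> kres M)
   (fun S x => if #|S| == u then gpart e (x : M) else x = 0) (fun S c => c S)).
- exact: kpart_subspace.
- by move=> S a c d; rewrite !ffunE.
- by move=> c hc S; apply: hc.
- by move=> c _ hc; apply/ffunP => S; rewrite hc ffunE.
- move=> y hy; exists [ffun S => y S] => [S|S]; rewrite ffunE //; exact: hy.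
- by move=> S; case: (#|S| == u); [apply: gpart_subspace|apply: zerosp_subspace].
- by move=> S; case: (#|S| == u) => //; apply: vdim0.
Qed.

Lemma vdim_kcycle_exists u e b : vdim (kpart u e) b -> exists z, vdim (kcycle u e) z.
Proof.
move=> hb; have [] := qdim_sub (kcycle_subspace u e) (@zerosp_subspace _ _) _ hb.
  by move=> c [].
by move=> z _ hz; exists z.
Qed.

(** If the linear forms act faithfully on the degree-zero part, spanned by [g],
    the first step of each linear strand is injective. *)
Lemma vdim_kcycle_linear (g : M) u :
  vdim (gpart 0 : kres M -> Prop) 1 ->
  (forall x, gpart 0 x -> exists a : K, x = (a *: (g : kres M) : kres M)) ->
  (forall a : 'I_n -> K, \sum_j a j *: kop j g = 0 -> forall j, a j = 0) ->
  vdim (kcycle u 0) (u == 0%N).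
Proof.
move=> h1 gen ind; case: u => [|u] /=.
  apply: (qdim_ext (Z := kpart 0 0) (B := @zerosp _ _)) => // [c|].
    by rewrite kcycle0.
  by have := vdim_kpart 0 h1; rewrite bin0.
apply: vdim0 => c [pc dc]; apply/ffunP => S; rewrite ffunE.
have := pc S; case: eqP => // Su _.
have [j jS] : exists j, j \in S by apply/set0Pn; rewrite -card_gt0 Su.
have /fin_all_exists[a ha] T : exists a : K, c T = a *: (g : kres M).
  have := pc T; case: eqP => [_ /gen//|_ ->]; by exists 0; rewrite scale0r.
pose T := S :\ j.
have TT : #|T| = u by move: Su; rewrite (cardsD1 j S) jS => -[].
have /ffunP/(_ T) := dc; rewrite !ffunE => dT.
(* The coefficient of the differential at [S] minus [j] is a linear form in
   [g] whose [j]-th coefficient is, up to sign, the one of the chain at [S]. *)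
have := ind (fun k => if k \notin T then ksgn K k T * a (k |: T) else 0).
have -> : \sum_k (if k \notin T then ksgn K k T * a (k |: T) else 0) *: kop k g = 0.
  rewrite -[RHS]dT [RHS]big_mkcond; apply: eq_bigr => k _.
  case: ifP => _; last by rewrite scale0r.
  by rewrite ha kopZ scalerA.
move=> /(_ erefl j); rewrite !inE eqxx /= => /eqP.
rewrite mulf_eq0 setD1K // ha => /orP[|/eqP->]; last by rewrite scale0r.
rewrite /ksgn prodf_seq_eq0 => /hasP[i _] /andP[_].
by case: ifP; rewrite ?oppr_eq0 oner_eq0.
Qed.

End TorKoszul.

(** * Graded quotients of a polynomial ring *)

Section GradedQuotient.
Variables (K : fieldType) (n : nat) (a : hideal K n).
Local Notation P := {mpoly K[n]}.
Local Notation M := (galg_module a).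

Lemma galg_scaleE (c : K) (x : kres M) : c *: x =
  (galg_pi a c%:MP * (x : galg a) : galg a).
Proof. by []. Qed.

Lemma galg_part_finite e :
  exists h, vdim (galg_part e : kres M -> Prop) h.
Proof.
pose b (k : 'I_#|{: 'X_{1..n < e.+1}}|) : kres M :=
  (galg_pi a 'X_[val (enum_val k : 'X_{1..n < e.+1})] : galg a).
have [] := @qdim_of_span K (kres M) (galg_part e) (@zerosp _ _) _ b
  (gpart_subspace M e) (@zerosp_subspace _ _); last by move=> h _; exists h.
move=> _ [p hp <-]; exists (fun k => p@_(enum_val k : 'X_{1..n < e.+1})).
have pe : (msize p <= e.+1)%N.
  rewrite msizeE; apply/bigmax_leqP_seq => m mp _.
  by rewrite (dhomogP _ _ _ hp _ mp).
rewrite /zerosp; apply/eqP; rewrite subr_eq0; apply/eqP.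
rewrite {1}(mpolywE pe) rmorph_sum /=.
rewrite (big_enum_val (A := {: 'X_{1..n < e.+1}})
  (fun m => galg_pi a (p@_m *: 'X_[m]))).
by apply: eq_bigr => k _; rewrite galg_scaleE -mul_mpolyC rmorphM.
Qed.

Lemma homog0_const (p : P) : p \is 0.-homog -> p = (p@_0%MM)%:MP.
Proof.
move=> hp; apply/mpolyP => m; rewrite mcoeffC.
case: eqP => [->|/eqP m0]; first by rewrite mulr1.
by rewrite mulr0 (dhomog_nemf_coeff hp) // mdeg_eq0.
Qed.

Lemma galg_part0_gen (x : kres M) :
  galg_part 0 x -> exists c : K, x = c *: ((1 : galg a) : kres M).
Proof.
by case=> p /homog0_const -> <-; exists p@_0%MM; rewrite galg_scaleE mulr1.
Qed.

Lemma galg_part0_dim : vdim (galg_part 0 : kres M -> Prop) 1.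
Proof.
exists (fun=> (1 : galg a) : kres M); split=> [_|x /galg_part0_gen[c ->]|c].
- by exists 1; rewrite ?dhomog1 ?rmorph1.
- by exists (fun=> c); rewrite big_ord1 subrr.
rewrite big_ord1 galg_scaleE mulr1 /zerosp => c0 k; rewrite ord1.
have : galg_pi a (c ord0)%:MP = galg_pi a 0 by rewrite rmorph0.
by move/galg_pi_eq/hideal_mcoeff0; rewrite subr0 mcoeffC eqxx mulr1.
Qed.

Hypothesis irr2 : forall p : P, p \in hideal_val a -> in_irr2 p.

(** The ideal contains no linear form, as its elements have order at least two. *)
Lemma galg_linear_free (c : 'I_n -> K) :
  galg_pi a (\sum_j c j *: 'X_j) = 0 -> forall j, c j = 0.
Proof.
move=> h j; have : galg_pi a (\sum_j c j *: 'X_j) = galg_pi a 0 by rewrite h rmorph0.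
move/galg_pi_eq; rewrite subr0 => /irr2[q /(congr1 (mcoeff U_(j)))].
rewrite !raddf_sum /= (bigD1 j) //= mcoeffZ mcoeffXU eqxx mulr1 big1 ?addr0; last first.
  by move=> i ij; rewrite mcoeffZ mcoeffXU (negPf ij) mulr0.
move->; rewrite big1 // => k _; rewrite raddf_sum big1 // => l _ /=.
rewrite -mpolyXD; apply: memN_msupp_eq0; rewrite (perm_mem (msuppMX _ _)).
apply/negP => /mapP[m _ /(congr1 (@mdeg n))].
by rewrite !mdegD !mdeg1 -addnA !add1n.
Qed.

Lemma galg_kcycle_linear u : vdim (@kcycle K n M u 0) (u == 0%N).
Proof.
apply: (@vdim_kcycle_linear K n M (1 : galg a)).
- exact: galg_part0_dim.
- exact: galg_part0_gen.
move=> c h; apply: galg_linear_free; rewrite rmorph_sum -[RHS]h.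
apply: eq_bigr => j _.
by rewrite galg_scaleE -mul_mpolyC rmorphM /= -[galg_pi a 'X_j]mulr1.
Qed.

End GradedQuotient.

(** * The fiber product *)

Section Fiber.
Variables (K : fieldType) (r : nat) (n : 'I_r -> nat).
Variable a : forall i, hideal K (n i).
Local Notation N := (\sum_i n i)%N.
Local Notation Q := {mpoly K[N]}.
Local Notation A i := (galg_module (a i)).
Local Notation F := (fiber_module a).

Definition coord i (x : kres F) : kres (A i) := fiber_coord (x : fiberp a) i.

Lemma coord_inj x y : (forall i, coord i x = coord i y) -> x = y.
Proof. exact: fiber_inj. Qed.

Lemma tens_projXU i k : @tens_proj K r n i ('X_k : Q) =
  \sum_(j < n i | tagnat.Rank i j == k) ('X_j : {mpoly K[n i]}).
Proof. by rewrite /= mmapX mmap1U. Qed.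

Lemma coord_linear i : linear (coord i).
Proof.
move=> c x y; rewrite /coord fiber_coordD fiber_coordM fiber_pi_funE.
by rewrite /= mmapC.
Qed.

(** Only the variables of the [i]-th ring act on the [i]-th coordinate. *)
Lemma coord_kop i k x :
  coord i (kop k x) = \sum_(j < n i | tagnat.Rank i j == k) kop j (coord i x).
Proof.
rewrite /coord fiber_coordM fiber_pi_funE tens_projXU rmorph_sum mulr_suml.
by apply: eq_bigr.
Qed.

(** Elements without constant term are subject to no compatibility condition:
    in positive degrees the fiber product is a direct product. *)
Lemma fiber_ex (y : forall i, galg (a i)) : (forall i, galg_aug (a i) (y i) = 0) ->
  exists x : kres F, forall i, coord i x = y i.
Proof.
move=> h; have h' i j : galg_aug (a i) (y i) = galg_aug (a j) (y j) by rewrite !h.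
by exists (fiber_of h') => i; rewrite /coord fiber_ofE.
Qed.

Lemma galg_aug_part i e (y : kres (A i)) : galg_part e.+1 y -> galg_aug (a i) y = 0.
Proof. by case=> p hp <-; rewrite galg_augE (homog_mcoeff0 hp). Qed.

Lemma Rank_lt i (j k : 'I_(n i)) : (tagnat.Rank i j < tagnat.Rank i k)%N = (j < k)%N.
Proof. by rewrite !tagnat.RankEsum ltn_add2l. Qed.

Lemma Rank_inj i : injective (@tagnat.Rank r n i).
Proof. by move=> j k /tagnat.rank_inj /eqP; rewrite eq_Tagged => /eqP. Qed.

(** ** Decomposition of Koszul cycles in positive degrees *)

(** For each [i], a set of variables of the big ring is the [join] of a set of
    variables of the [i]-th ring, its [trace], and a set disjoint from [own i]. *)
Definition own i : {set 'I_N} := [set tagnat.Rank i j | j : 'I_(n i)].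
Definition trace i (S : {set 'I_N}) : {set 'I_(n i)} := [set j | tagnat.Rank i j \in S].
Definition join i (S : {set 'I_(n i)}) (T : {set 'I_N}) : {set 'I_N} :=
  [set tagnat.Rank i j | j in S] :|: T.

Lemma mem_own i j : tagnat.Rank i j \in own i.
Proof. by apply/imsetP; exists j. Qed.

Lemma join_trace i (S : {set 'I_N}) : join (trace i S) (S :\: own i) = S.
Proof.
apply/setP => k; rewrite !inE; apply/orP/idP => [[/imsetP[j]|/andP[]//]|kS].
  by rewrite inE => jS ->.
case: (boolP (k \in own i)) => [/imsetP[j _ kj]|_]; last by right.
by left; apply/imsetP; exists j => //; rewrite inE -kj.
Qed.

Section Disjoint.
Variables (i : 'I_r) (T : {set 'I_N}).
Hypothesis dT : [disjoint T & own i].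

Lemma own_notin j : tagnat.Rank i j \notin T.
Proof. by apply/negP => jT; have := disjointFr dT jT; rewrite mem_own. Qed.

Lemma mem_join j (S : {set 'I_(n i)}) : (tagnat.Rank i j \in join S T) = (j \in S).
Proof.
by rewrite inE (negPf (own_notin j)) orbF mem_imset //; apply: Rank_inj.
Qed.

Lemma trace_join (S : {set 'I_(n i)}) : trace i (join S T) = S.
Proof. by apply/setP => j; rewrite inE mem_join. Qed.

Lemma join_own (S : {set 'I_(n i)}) : join S T :\: own i = T.
Proof.
apply/setP => k; rewrite !inE; case: (boolP (k \in own i)) => [ko|kN] /=.
  by apply/esym/negP => kT; have := disjointFr dT kT; rewrite ko.
case: imsetP => [[j _ kj]|] //; first by rewrite kj mem_own in kN.
Qed.

Lemma disjoint_join (S : {set 'I_(n i)}) :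
  [disjoint [set tagnat.Rank i j | j in S] & T].
Proof.
rewrite disjoint_sym; apply: disjointWr dT.
by apply/subsetP => k /imsetP[j _ ->]; apply: mem_own.
Qed.

Lemma card_join (S : {set 'I_(n i)}) : #|join S T| = (#|S| + #|T|)%N.
Proof.
have := disjoint_join S; rewrite -setI_eq0 => /eqP d0.
by rewrite cardsU d0 cards0 subn0 card_imset //; apply: Rank_inj.
Qed.

Lemma joinU1 j (S : {set 'I_(n i)}) : join (j |: S) T = tagnat.Rank i j |: join S T.
Proof. by rewrite /join imsetU1 setUA. Qed.

(** The sign by which the wedge of [T] with the variable [j] of the [i]-th ring
    differs from the one of the two in increasing order. *)
Definition cross (j : 'I_(n i)) : K := ksgn K (tagnat.Rank i j) T.

Definition shuffle (S : {set 'I_(n i)}) : K := \prod_(j in S) cross j.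

Lemma ksgn_join j (S : {set 'I_(n i)}) :
  ksgn K (tagnat.Rank i j) (join S T) = ksgn K j S * cross j.
Proof.
transitivity (\prod_(k in [set tagnat.Rank i j | j in S])
    (if (k < tagnat.Rank i j)%N then -1 else 1 : K)
   * cross j).
  by rewrite -bigU /=; [apply: eq_bigl => k; rewrite !inE|exact: disjoint_join].
congr (_ * _); rewrite big_imset /=; last by move=> k l _ _; apply: Rank_inj.
by apply: eq_bigr => k _; rewrite Rank_lt.
Qed.

Lemma cross2 j : cross j * cross j = 1.
Proof.
rewrite /cross /ksgn -big_split big1 //= => k _.
by case: ifP; rewrite ?mulrNN mulr1.
Qed.

Lemma shuffle2 (S : {set 'I_(n i)}) : shuffle S * shuffle S = 1.
Proof. by rewrite /shuffle -big_split big1 //= => j _; apply: cross2. Qed.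

End Disjoint.

Local Notation chainF := {ffun {set 'I_N} -> kres F}.
Local Notation chainA i := {ffun {set 'I_(n i)} -> kres (A i)}.

(** The component of a chain attached to the pair of a coordinate [i] and a set
    [T] of variables that kill it: the coefficients, in the [i]-th coordinate, of
    the wedges containing exactly [T] outside the [i]-th ring. The sign
    turns the big differential into the one of the [i]-th ring. Pairs for
    which [T] meets [own i] only pad the index type. *)
Definition strand (x : 'I_r * {set 'I_N}) (c : chainF) : chainA x.1 :=
  [ffun S => if [disjoint x.2 & own x.1]
    then shuffle x.2 S *: coord x.1 (c (join S x.2)) else 0].

Lemma strand_linear x : linear (strand x).
Proof.
move=> b c d; apply/ffunP => S; rewrite !ffunE; case: ifP => _.
  by rewrite coord_linear scalerDr !scalerA mulrC.
by rewrite scaler0 addr0.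
Qed.

Lemma strand_inj c : (forall x, strand x c = 0) -> c = 0.
Proof.
move=> h; apply/ffunP => S; apply: coord_inj => i.
have dT : [disjoint S :\: own i & own i].
  by rewrite -setI_eq0 setIDAC setDIl setDv setI0.
have /ffunP/(_ (trace i S)) := h (i, S :\: own i).
rewrite !ffunE /= dT join_trace => E.
rewrite -[LHS]scale1r -(shuffle2 (S :\: own i) (trace i S)) -scalerA E scaler0.
by rewrite /coord fiber_coord0.
Qed.

(** A variable outside the [i]-th ring kills the [i]-th coordinate, so the
    differential leaves [T] unchanged. *)
Lemma strand_kdif x c : strand x (kdif c) = kdif (strand x c).
Proof.
case: x => i T; apply/ffunP => S; rewrite !ffunE /=; case: ifP => dT; last first.
  by rewrite big1 // => j _; rewrite ffunE /= dT /kop !scaler0.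
have lc := coord_linear i.
have coord_sum (J : finType) (R : pred J) (f : J -> kres F) :
    coord i (\sum_(j | R j) f j) = \sum_(j | R j) coord i (f j).
  apply: (big_morph (coord i)) => [u v|]; last by rewrite /coord fiber_coord0.
  by rewrite /coord fiber_coordD.
rewrite coord_sum.
have -> : \sum_(k | k \notin join S T)
      coord i (ksgn K k (join S T) *: kop k (c (k |: join S T))) =
    \sum_(k | k \notin join S T) \sum_(j < n i | tagnat.Rank i j == k)
      ksgn K (tagnat.Rank i j) (join S T) *:
        kop j (coord i (c (tagnat.Rank i j |: join S T))).
  apply: eq_bigr => k _.
  rewrite -[_ *: kop k _]addr0 lc coord_kop scaler_sumr.
  rewrite [X in _ + X]fiber_coord0 addr0.
  by apply: eq_bigr => j /eqP ->.
rewrite (exchange_big_dep (fun j => j \notin S)) /=; last first.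
  by move=> k j kS /eqP jk; rewrite -(mem_join dT) jk.
rewrite scaler_sumr; apply: eq_bigr => j jS.
rewrite (big_pred1 (tagnat.Rank i j)); last first.
  move=> k /=; rewrite eq_sym; case: eqVneq => [->|]; last by rewrite andbF.
  by rewrite mem_join // jS.
rewrite ffunE /= dT joinU1 kopZ !scalerA ksgn_join // [shuffle T (j |: S)]big_setU1 //=.
by rewrite [shuffle T S * _]mulrC mulrA.
Qed.

(** Where the component of a chain of degree [u] lies: removing [T] lowers the
    homological degree by its cardinal, and keeps [e]. *)
Definition strand_part u e (x : 'I_r * {set 'I_N}) (c : chainA x.1) : Prop :=
  if [disjoint x.2 & own x.1] && (#|x.2| <= u)%N
  then @kpart K (n x.1) (A x.1) (u - #|x.2|) e c else c = 0.

Definition strand_cycle u e (x : 'I_r * {set 'I_N}) (c : chainA x.1) : Prop :=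
  if [disjoint x.2 & own x.1] && (#|x.2| <= u)%N
  then @kcycle K (n x.1) (A x.1) (u - #|x.2|) e c else c = 0.

Lemma strand_partP u e x c : @kpart K N F u e c -> strand_part u e (strand x c).
Proof.
case: x => i T hc; rewrite /strand_part /=; case: (boolP [disjoint T & own i]) => dT;
  last first.
  by apply/ffunP => S; rewrite !ffunE /= (negPf dT).
have E S : #|join S T| == u -> galg_part e (strand (i, T) c S).
  move=> Su; rewrite ffunE /= dT; apply: (subspaceZ (gpart_subspace (A i) e)).
  by have := hc (join S T); rewrite Su; apply.
have E0 S : #|join S T| != u -> strand (i, T) c S = 0.
  move=> Su; rewrite ffunE /= dT; have := hc (join S T); rewrite (negPf Su) => ->.
  by rewrite /coord fiber_coord0 scaler0.
case: leqP => Tu /=.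
  move=> S; have ES : (#|join S T| == u) = (#|S| == u - #|T|)%N.
    by rewrite card_join // -[RHS](eqn_add2r #|T|) subnK.
  by rewrite -ES; case: ifP => [/E|/negbT/E0].
apply/ffunP => S; rewrite E0 ?ffunE // card_join //.
by rewrite gtn_eqF // (leq_trans Tu) // leq_addl.
Qed.

(** In positive degree [e.+1] the coordinates of each coefficient may be
    prescribed independently. *)
Lemma strand_surj u e (y : forall x, chainA x.1) :
  (forall x, strand_part u e.+1 (y x)) ->
  exists2 c, @kpart K N F u e.+1 c & forall x, strand x c = y x.
Proof.
move=> hy.
pose w S i : kres (A i) := y (i, S :\: own i) (trace i S).
have dS S i : [disjoint S :\: own i & own i].
  by rewrite -setI_eq0 setIDAC setDIl setDv setI0.
have cS S i : (#|trace i S| + #|S :\: own i|)%N = #|S|.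
  by rewrite -card_join // join_trace.
have hw (S : {set 'I_N}) i : if #|S| == u then galg_part e.+1 (w S i) else w S i = 0.
  have := hy (i, S :\: own i); rewrite /strand_part /= dS /= -(cS S i) /w.
  case: leqP => [le /(_ (trace i S))|lt ->].
    by rewrite -[X in if X then _ else _](eqn_add2r #|S :\: own i|) subnK.
  by rewrite gtn_eqF ?ffunE // (leq_trans lt) // leq_addl.
have hw1 (S : {set 'I_N}) i : galg_part e.+1 (w S i).
  by have := hw S i; case: ifP => // _ ->; apply: galg_part0.
have /fin_all_exists[c hc] S : exists x : kres F, forall i,
    coord i x = shuffle (S :\: own i) (trace i S) *: w S i.
  apply: fiber_ex => i; apply: (@galg_aug_part i e).
  exact: (subspaceZ (gpart_subspace (A i) e.+1) _ (hw1 S i)).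
exists [ffun S => c S] => [S|[i T]].
  rewrite ffunE; case: ifP => Su.
    move=> i; rewrite -/(coord i (c S)) hc.
    exact: (subspaceZ (gpart_subspace (A i) e.+1) _ (hw1 S i)).
  apply: coord_inj => i; rewrite hc; have := hw S i; rewrite Su => ->.
  by rewrite scaler0 /coord fiber_coord0.
apply/ffunP => S; rewrite !ffunE /=; case: (boolP [disjoint T & own i]) => dT.
  by rewrite hc /w join_own // trace_join // scalerA shuffle2 scale1r.
by have := hy (i, T); rewrite /strand_part /= (negPf dT) /= => ->; rewrite ffunE.
Qed.

Section Count.
Variables (b z : forall i : 'I_r, nat -> nat -> nat).
Hypothesis hb : forall i u e, vdim (@kpart K (n i) (A i) u e) (b i u e).
Hypothesis hz : forall i u e, vdim (@kcycle K (n i) (A i) u e) (z i u e).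

Definition strand_sum (f : 'I_r -> nat -> nat -> nat) u e : nat :=
  \sum_(x : 'I_r * {set 'I_N})
    if [disjoint x.2 & own x.1] && (#|x.2| <= u)%N then f x.1 (u - #|x.2|)%N e else 0.

Lemma fiber_kpart_dim u e : vdim (@kpart K N F u e.+1) (strand_sum b u e.+1).
Proof.
apply: (vdim_product (p := strand) (Y := strand_part u e.+1)).
- exact: kpart_subspace.
- exact: strand_linear.
- by move=> c hc x; apply: strand_partP.
- by move=> c _; apply: strand_inj.
- exact: strand_surj.
- move=> x; rewrite /strand_part; case: (_ && _); first exact: kpart_subspace.
  exact: zerosp_subspace.
- move=> x; rewrite /strand_part; case: (_ && _); first exact: hb.
  exact: vdim0.
Qed.

Lemma strand_cycleE u e x (c : chainA x.1) :
  strand_cycle u e c <-> strand_part u e c /\ kdif c = 0.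
Proof.
rewrite /strand_cycle /strand_part; case: (_ && _) => //.
by split=> [->|[]//]; split=> //; exact: linear_zero (@kdif_linear _ _ _).
Qed.

Lemma fiber_kcycle_dim u e : vdim (@kcycle K N F u e.+1) (strand_sum z u e.+1).
Proof.
apply: (vdim_product (p := strand) (Y := strand_cycle u e.+1)).
- exact: kcycle_subspace.
- exact: strand_linear.
- move=> c [hc dc] x; apply/strand_cycleE; split; first exact: strand_partP.
  by rewrite -strand_kdif dc (linear_zero (strand_linear x)).
- by move=> c _; apply: strand_inj.
- move=> y hy; have [|c hc cy] := @strand_surj u e y.
    by move=> x; case/strand_cycleE: (hy x).
  exists c => //; split=> //; apply: strand_inj => x.
  by rewrite strand_kdif cy; case/strand_cycleE: (hy x).
- move=> x; rewrite /strand_cycle; case: (_ && _); first exact: kcycle_subspace.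
  exact: zerosp_subspace.
- move=> x; rewrite /strand_cycle; case: (_ && _); first exact: hz.
  exact: vdim0.
Qed.

End Count.

(** ** The linear strand *)

Hypothesis r_gt0 : (0 < r)%N.
Hypothesis irr2 : forall i (p : {mpoly K[n i]}), p \in hideal_val (a i) -> in_irr2 p.

Lemma fiber_part0_gen (x : kres F) :
  fiber_part 0 x -> exists c : K, x = c *: ((1 : fiberp a) : kres F).
Proof.
move=> hx; pose i0 := Ordinal r_gt0.
have /fin_all_exists[c hc] i : exists c : K,
  coord i x = c *: ((1 : galg (a i)) : kres (A i)).
  exact: galg_part0_gen (hx i).
have cE i : galg_aug (a i) (coord i x) = c i.
  by rewrite hc galg_scaleE mulr1 galg_augE mcoeffC eqxx mulr1.
have c0 i : c i = c i0.
  by rewrite -!cE; exact: (@fiber_coordP K r _ (fun i => galg_aug (a i)) x).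
exists (c i0); apply: coord_inj => i.
rewrite hc c0 -[X in coord i X]addr0 coord_linear [coord i 0]fiber_coord0 addr0.
by rewrite [coord i 1]fiber_coord1.
Qed.

Lemma coord1 i : coord i ((1 : fiberp a) : kres F) = (1 : galg (a i)).
Proof. exact: fiber_coord1. Qed.

Lemma fiber_part0_dim : vdim (fiber_part 0 : kres F -> Prop) 1.
Proof.
pose i0 := Ordinal r_gt0.
exists (fun=> (1 : fiberp a) : kres F); split=> [_ i|x /fiber_part0_gen[c ->]|c].
- by rewrite -/(coord i _) coord1; exists 1; rewrite ?dhomog1 ?rmorph1.
- by exists (fun=> c); rewrite big_ord1 subrr.
move=> h k; rewrite ord1; move: h; rewrite big_ord1 => /(congr1 (coord i0)).
rewrite -[X in coord i0 X]addr0 coord_linear [coord i0 0]fiber_coord0 addr0 coord1.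
rewrite galg_scaleE mulr1 => c0.
have : galg_pi (a i0) (c ord0)%:MP = galg_pi (a i0) 0 by rewrite rmorph0.
by move/galg_pi_eq/hideal_mcoeff0; rewrite subr0 mcoeffC eqxx mulr1.
Qed.

(** As the ideals lie in the squares of the irrelevant ideals, no linear form of
    the big ring vanishes in the fiber product. *)
Lemma fiber_kcycle_linear u : vdim (@kcycle K N F u 0) (u == 0%N).
Proof.
apply: (@vdim_kcycle_linear K N F (1 : fiberp a)).
- exact: fiber_part0_dim.
- exact: fiber_part0_gen.
move=> c h k; rewrite -[k]tagnat.sig2K; set i := tagnat.sig1 k; set j := tagnat.sig2 k.
apply: (galg_linear_free (irr2 (i := i)) (c := fun j => c (tagnat.Rank i j))).
have {h} : coord i (\sum_j c j *: kop j ((1 : fiberp a) : kres F)) = 0.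
  by rewrite h /coord fiber_coord0.
rewrite linear_comb; last exact: coord_linear.
have -> : \sum_k c k *: coord i (kop k ((1 : fiberp a) : kres F)) =
    \sum_k \sum_(j < n i | tagnat.Rank i j == k)
      c k *: kop j ((1 : galg (a i)) : kres (A i)).
  by apply: eq_bigr => l _; rewrite coord_kop coord1 scaler_sumr.
rewrite (exchange_big_dep predT) //= => h; rewrite rmorph_sum -[RHS]h.
apply: eq_bigr => l _; rewrite (big_pred1 (tagnat.Rank i l)) //.
by rewrite galg_scaleE -mul_mpolyC rmorphM /= -[galg_pi (a i) 'X_l]mulr1.
Qed.

End Fiber.

(** * Betti numbers of the fiber product *)

Section Betti.
Variables (K : fieldType) (r : nat) (n : 'I_r -> nat).
Variable a : forall i, hideal K (n i).
Hypothesis r_gt0 : (0 < r)%N.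
Hypothesis irr2 : forall i (p : {mpoly K[n i]}), p \in hideal_val (a i) -> in_irr2 p.
Local Notation N := (\sum_i n i)%N.
Local Notation A i := (galg_module (a i)).
Local Notation F := (fiber_module a).

(** Bigraded Betti numbers, [e] being the distance to the linear strand. *)
Definition betti (m : nat) (M : gmodule K m) u e : nat :=
  tor_dim M (resfield K m) u (u + e).

Lemma n_le_N i : (n i <= N)%N.
Proof. by rewrite (bigD1 i) //= leq_addr. Qed.

Lemma card_own i : #|own n i| = n i.
Proof. by rewrite card_imset ?card_ord //; apply: Rank_inj. Qed.

(** Group the sets [T] by cardinality. *)
Lemma sum_disjoint i (g : nat -> nat) u :
  (\sum_(T : {set 'I_N})
      (if [disjoint T & own n i] && (#|T| <= u)%N then g #|T| else 0) =
   \sum_(k < u.+1) 'C(N - n i, k) * g k)%N.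
Proof.
rewrite -big_mkcond
  (partition_big (fun T : {set 'I_N} => inord #|T| : 'I_u.+1) predT) //=.
apply: eq_bigr => k _.
have -> : 'C(N - n i, k) = #|[set T : {set 'I_N} | T \subset ~: own n i & #|T| == k]|.
  by rewrite cards_draws cardsCs setCK card_ord card_own.
rewrite -sum_nat_const; apply: eq_big => [T|T].
  rewrite inE disjoints_subset -andbA; congr (_ && _).
  apply/andP/eqP => [[Tu /eqP <-]|->]; first by rewrite inordK.
  by rewrite -ltnS ltn_ord inord_val.
by case/andP=> /andP[_ Tu] /eqP <-; rewrite inordK.
Qed.

Lemma strand_sumE f u e :
  (strand_sum n f u e = \sum_i \sum_(k < u.+1) 'C(N - n i, k) * f i (u - k) e)%N.
Proof.
rewrite /strand_sum.
rewrite -(pair_bigA _ (fun i (T : {set 'I_N}) =>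
   if [disjoint T & own n i] && (#|T| <= u)%N
   then f i (u - #|T|)%N e else 0)%N) /=.
by apply: eq_bigr => i _; rewrite (sum_disjoint i (fun k => f i (u - k)%N e)).
Qed.

Lemma betti_galg0 i u : betti (A i) u 0 = (u == 0%N).
Proof.
by rewrite /betti addn0; exact: tor_dim_linear (galg_kcycle_linear (@irr2 i) u).
Qed.

Lemma betti_fiber0 u : betti F u 0 = (u == 0%N).
Proof.
by rewrite /betti addn0; exact: tor_dim_linear (fiber_kcycle_linear r_gt0 irr2 u).
Qed.

Lemma dims_exist : exists b z : forall i : 'I_r, nat -> nat -> nat,
  (forall i u e, vdim (@kpart K (n i) (A i) u e) (b i u e)) /\
  (forall i u e, vdim (@kcycle K (n i) (A i) u e) (z i u e)).
Proof.
pose h i e := proj1_sig (constructive_indefinite_description _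
  (galg_part_finite (a i) e)).
have hb i u e : vdim (@kpart K (n i) (A i) u e) ('C(n i, u) * h i e).
  apply: vdim_kpart; rewrite /h; by case: constructive_indefinite_description.
have hz i u e := vdim_kcycle_exists (hb i u e).
exists (fun i u e => 'C(n i, u) * h i e)%N.
exists (fun i u e => proj1_sig (constructive_indefinite_description _ (hz i u e))).
by split=> // i u e; case: constructive_indefinite_description.
Qed.

(** The cycles of the fiber product split along its factors, but the boundaries
    do not: they come from chains with constant coefficients, of which the
    fiber product has one copy for all the factors together. *)
Lemma betti_fiber1 u :
  (betti F u 1 + 'C(N, u.+1) + \sum_i 'C(N - n i, u.+1) =
   \sum_i \sum_(k < u.+1) 'C(N - n i, k) * betti (A i) (u - k) 1 + r * 'C(N, u.+1))%N.
Proof.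
have [b [z [hb hz]]] := dims_exist.
have := tor_dim_count (fiber_kcycle_dim hz u 0)
  (vdim_kpart u.+1 (fiber_part0_dim a r_gt0)) (fiber_kcycle_linear r_gt0 irr2 u.+1).
rewrite muln1 /= addn0 -/(betti F u 1) => ->.
rewrite strand_sumE -[X in (_ = _ + X * _)%N]card_ord -sum_nat_const -!big_split /=.
apply: eq_bigr => i _.
have bz w : z i w 1%N = (betti (A i) w 1 + 'C(n i, w.+1))%N.
  have := tor_dim_count (hz i w 1%N) (vdim_kpart w.+1 (galg_part0_dim (a i)))
    (galg_kcycle_linear (@irr2 i) w.+1).
  by rewrite muln1 /= addn0 => <-.
under eq_bigr do rewrite bz mulnDr.
rewrite big_split /= -addnA; congr (_ + _)%N.
have -> : 'C(N, u.+1) = (\sum_(k < u.+2) 'C(N - n i, k) * 'C(n i, u.+1 - k))%N.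
  by rewrite binomial.Vandermonde subnK // n_le_N.
rewrite [RHS]big_ord_recr /= subnn bin0 muln1.
by congr (_ + _)%N; apply: eq_bigr => k _; rewrite subSn // -ltnS.
Qed.

(** Farther from the linear strand all the chains involved have coefficients of
    positive degree, where the fiber product is the product of its factors. *)
Lemma betti_fiber2 u e :
  (betti F u e.+2 =
   \sum_i \sum_(k < u.+1) 'C(N - n i, k) * betti (A i) (u - k) e.+2)%N.
Proof.
have [b [z [hb hz]]] := dims_exist.
have := tor_dim_count (fiber_kcycle_dim hz u e.+1) (fiber_kpart_dim hb u.+1 e)
  (fiber_kcycle_dim hz u.+1 e).
rewrite -/(betti F u e.+2) => E; apply/eqP;
  rewrite -(eqn_add2r (strand_sum n b u.+1 e.+1)) E.
rewrite !strand_sumE -!big_split /=; apply/eqP; apply: eq_bigr => i _.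
(* The terms with [u.+1] variables outside the [i]-th ring cancel, all chains of
   homological degree zero being cycles. *)
rewrite ![\sum_(k < u.+2) _]big_ord_recr /= subnn !addnA -!big_split /=.
congr (_ + _ * _)%N; last first.
  apply: (qdim_uniq (zerosp_subspace _) (hz i 0%N e.+1)).
  by apply: qdim_ext (hb i 0%N e.+1) => // c; rewrite kcycle0.
apply: eq_bigr => k _; have ku : (k <= u)%N by rewrite -ltnS.
rewrite (subSn ku) -!mulnDr /betti; congr muln; apply: esym.
exact: tor_dim_count (hz i (u - k)%N e.+2) (hb i (u - k).+1 e.+1)
  (hz i (u - k).+1 e.+1).
Qed.

End Betti.

(** * The Poincare series *)

Section Series.
Local Notation s := svar.
Local Notation t := tvar.

Lemma coef_st k i j : ((s * t) ^+ k)`_i`_j = ((i == k) && (j == k))%:R.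
Proof.
rewrite exprMn -rmorphXn coefCM coefXn; case: eqP => _; last by rewrite mulr0 coef0.
by rewrite mulr1 coefXn.
Qed.

Lemma coef_binomial m i j :
  ((1 + s * t) ^+ m)`_i`_j = if i == j then 'C(m, i)%:Z else 0.
Proof.
rewrite addrC exprD1n coef_sum coef_sum.
under eq_bigr do rewrite !coefMn coef_st.
case: (ltnP i m.+1) => im.
  rewrite (bigD1 (Ordinal im)) //= eqxx big1 ?addr0 => [|k ki].
    by rewrite [j == i]eq_sym; case: eqP; rewrite ?mul0rn // natz.
  by rewrite eq_sym -[i]/(val (Ordinal im)) val_eqE (negPf ki) mul0rn.
rewrite bin_small // if_same big1 // => k _.
by rewrite gtn_eqF ?mul0rn // (leq_trans (ltn_ord k)).
Qed.

(** The correction terms only affect the coefficient of [t ^ 0 * s], where they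
    cancel the binomial coefficient. *)
Lemma coef_divt m i j :
  (divt ((1 + s * t) ^+ m - m%:R * s * t - 1))`_i`_j =
  if (i.+1 == j) && (0 < i)%N then 'C(m, i.+1)%:Z else 0.
Proof.
rewrite coef_drop_poly addn1 !coefB coef_binomial -mulrA mulr_natl !coefMn.
rewrite -[s * t]expr1 coef_st coef1 /= coef0 subr0.
case: i => [|i] /=; last by rewrite mul0rn subr0 andbT.
by rewrite bin1 andbF eq_sym; case: eqP; rewrite ?mul0rn ?subr0 // natz subrr.
Qed.

(** Multiplying by a power of [1 + s t] preserves the difference of the two
    degrees. *)
Lemma series_mul_binomial f m u v :
  (forall k l, (l < k)%N -> f k l = 0) ->
  series_mul f (series_of ((1 + s * t) ^+ m)) u v =
  if (u <= v)%N then \sum_(k < u.+1) 'C(m, k)%:Z * f (u - k)%N (v - k)%N else 0.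
Proof.
move=> f0; rewrite /series_mul /series_of.
under eq_bigr do under eq_bigr do rewrite coef_binomial.
case: leqP => uv; last first.
  rewrite big1 // => k _; rewrite big1 // => l _.
  case: eqP => [E|_]; last by rewrite mulr0.
  rewrite f0 ?mul0r //; have := ltn_ord k; have := ltn_ord l; rewrite !ltnS => lv ku.
  by rewrite -(ltn_add2r (u - k)) {1}E subnKC // subnKC.
rewrite [RHS](reindex_inj rev_ord_inj) /=; apply: eq_bigr => k _.
have ku : (k <= u)%N by rewrite -ltnS.
have lv : (v - (u - k) < v.+1)%N by rewrite ltnS leq_subr.
rewrite (bigD1 (Ordinal lv)) //= subSS !subKn ?(leq_trans (leq_subr _ _) uv) // eqxx.
rewrite mulrC big1 ?addr0 // => l lk; case: eqP => [E|_]; last by rewrite mulr0.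
case/eqP: lk; apply: val_inj; rewrite /= E subKn // -ltnS ltn_ord.
by [].
Qed.

End Series.

Theorem corollary3p14 (K : fieldType) (r : nat) (n : 'I_r -> nat)
    (a : forall i : 'I_r, hideal K (n i)) :
  (2 <= r)%N ->
  (forall i, 1 <= n i)%N ->
  (forall i (p : {mpoly K[n i]}), p \in hideal_val (a i) -> in_irr2 p) ->
  let N := (\sum_i n i)%N in
  let s := svar in
  let t := tvar in
  forall u v : nat,
    poincare (fiber_module a) u v =
      \sum_i series_mul
               (series_sub (poincare (galg_module (a i))) (series_of 1))
               (series_of ((1 + s * t) ^+ (N - n i))) u v
      + series_of
          ((r - 1)%:R * divt ((1 + s * t) ^+ N - N%:R * s * t - 1)
           - \sum_i divt ((1 + s * t) ^+ (N - n i) - (N - n i)%:R * s * t - 1)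
           + 1) u v.
Proof.
move=> r2 n1 irr2 N s t u v; have r0 : (0 < r)%N by apply: leq_trans r2.
pose f i := series_sub (poincare (galg_module (a i))) (series_of 1).
have fE i k l : f i k l = (tor_dim (galg_module (a i)) (resfield K (n i)) k l)%:Z
    - ((k == 0%N) && (l == 0%N))%:R.
  by rewrite /f /series_sub /series_of coef1; case: k => [|k]; rewrite /= ?coef1 ?coef0.
have f_low i k l : (l < k)%N -> f i k l = 0.
  move=> lk; rewrite fE tor_dim_low //.
  by case: k lk => // k lk; rewrite subr0.
have f_diag i k e : f i k (k + e)%N =
    if e == 0%N then 0 else (betti (galg_module (a i)) k e)%:Z.
  rewrite fE; case: e => [|e] /=.
    rewrite -/(betti _ k 0) betti_galg0 // addn0 andbb.
    by case: eqP => _; rewrite ?subrr.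
  by rewrite -/(betti _ k e.+1) addn_eq0 andbF andbF subr0.
have secE : series_of ((r - 1)%:R * divt ((1 + s * t) ^+ N - N%:R * s * t - 1)
     - \sum_i divt ((1 + s * t) ^+ (N - n i) - (N - n i)%:R * s * t - 1) + 1) u v =
   (if (u.+1 == v) && (0 < u)%N
    then 'C(N, u.+1)%:Z *+ (r - 1) - \sum_i 'C(N - n i, u.+1)%:Z else 0)
   + ((u == 0%N) && (v == 0%N))%:R.
  rewrite /series_of !coefD !coefN !coef_sum mulr_natl !coefMn coef_divt.
  congr (_ + _); last by rewrite coef1; case: (u) => [|u']; rewrite /= ?coef1 ?coef0.
  under eq_bigr do rewrite coef_divt.
  by case: ifP => _ //; rewrite mul0rn big1 // subr0.
rewrite secE (eq_bigr _ (fun i _ => series_mul_binomial (N - n i) u v (@f_low i))).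
rewrite /poincare; case: (leqP u v) => [uv|vu]; last first.
  rewrite tor_dim_low // [X in _ = X + _]big1 // add0r.
  rewrite gtn_eqF ?(leq_trans vu) //= add0r.
  by case: (u) vu => // u'.
have [e ->] : exists e, v = (u + e)%N by exists (v - u)%N; rewrite subnKC.
have sumE : \sum_i \sum_(k < u.+1) 'C(N - n i, k)%:Z * f i (u - k)%N (u + e - k)%N =
  if e == 0%N then 0 else
    (\sum_i \sum_(k < u.+1) 'C(N - n i, k) * betti (galg_module (a i)) (u - k) e)%N%:Z.
  have termE i (k : 'I_u.+1) : f i (u - k)%N (u + e - k)%N =
      if e == 0%N then 0 else (betti (galg_module (a i)) (u - k) e)%:Z.
    have ku : (k <= u)%N by rewrite -ltnS.
    by rewrite -addnBAC // f_diag.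
  case: eqP termE => [_|_] termE.
    by rewrite big1 // => i _; rewrite big1 // => k _; rewrite termE mulr0.
  rewrite raddf_sum; apply: eq_bigr => i _; rewrite raddf_sum.
  by apply: eq_bigr => k _; rewrite termE -PoszM.
rewrite sumE -/(betti (fiber_module a) u e).
case: e {sumE uv secE} => [|[|e]] /=.
- rewrite betti_fiber0 // addn0 (gtn_eqF (ltnSn u)) /= !add0r andbb.
  by case: (u == 0%N).
- rewrite addn1 eqxx /= andbF addr0.
  have := betti_fiber1 r0 irr2 u; rewrite -/N.
  set S := (\sum_i \sum_(k < _) _)%N; set X := (\sum_i 'C(_, _))%N.
  case: ltnP => [_|]; last first.
    rewrite leqn0 => /eqP u0; rewrite addr0.
    (* In homological degree zero the binomial coefficients count variables, each
       of which lies outside all rings but one. *)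
    have -> : (r * 'C(N, u.+1) = 'C(N, u.+1) + X)%N.
      rewrite /X u0 bin1 -{1}[r]card_ord -sum_nat_const -/N -{2}[N]/(\sum_i n i)%N
        -big_split /=.
      apply: eq_bigr => i _; rewrite bin1 addnC subnK //.
      exact: n_le_N.
    by rewrite -addnA => /eqP; rewrite eqn_add2r => /eqP ->.
  have -> : \sum_i 'C(N - n i, u.+1)%:Z = X%:Z by rewrite raddf_sum.
  have -> c : (r * c = (r - 1) * c + c)%N by rewrite -mulSnr subn1 prednK.
  rewrite addnA addnAC => /eqP.
  rewrite eqn_add2r => /eqP /(congr1 Posz); rewrite !PoszD => E.
  by rewrite addrA -mulr_natl natz -PoszM -E addrK.
- have lt_uv : (u.+1 < u + e.+2)%N by rewrite !addnS !ltnS leq_addr.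
  rewrite betti_fiber2 // (ltn_eqF lt_uv) addn_eq0 /= andbF.
  by rewrite andbF !addr0.
Qed.
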